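(* Consider the system and notation described in the context. If $a_1\ge\sqrt{4d_1r}$, or if $0<a_1<\sqrt{4d_1r}$ and $L<L_1^*$, then $(0,\bar w)$ is globally asymptotically stable. If $0<a_1<\sqrt{4d_1r}$ and $L>L_1^*$, then: (i) if $L-x_2\ge L^*$ (large protection zone), then $(0,\bar w)$ is unstable; (ii) if $L-x_2<L^*$ (small protection zone), then: (ii.1) fixing all parameters except $h$ and $m$, there is a function $\bar m(h)$ such that $(0,\bar w)$ is linearly stable for $(h,m)\in\{h>0,\ m>\bar m(h)\}$ and unstable for $(h,m)\in\{h>0,\ 0<m<\bar m(h)\}$; (ii.2) fixing all parameters except $q$ and $m$, there is a function $\bar q(m)$ such that $(0,\bar w)$ is linearly stable for $(q,m)\in\{0<q<\bar q(m),\ m>0\}$ and unstable for $(q,m)\in\{q>\bar q(m),\ m>0\}$.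
   Context: Let $d_1,d_2,r,m,p,q,h,L>0$, $a_1>0$, $a_2\ge0$ and $0<x_2\le L$. Let $\chi_{[0,x_2)}(x)=1$ for $0\le x<x_2$ and $0$ for $x_2\le x\le L$. Consider the system $u_t=d_1u_{xx}-a_1u_x+u(r-u-m\chi_{[0,x_2)}w)$, $x\in(0,L)$, $t>0$; $w_t=d_2w_{xx}-a_2w_x+h-qw-puw$, $x\in(0,x_2)$, $t>0$; $d_1u_x(0,t)-a_1u(0,t)=u_x(L,t)=0$; $d_2w_x(0,t)-a_2w(0,t)=d_2w_x(x_2,t)-a_2w(x_2,t)=0$; nonnegative, not identically zero initial data $u_0$ on $[0,L]$, $w_0$ on $[0,x_2]$. Let $\bar w$ be the unique positive solution of $d_2w''-a_2w'+h-qw=0$ on $(0,x_2)$, $d_2w'(0)-a_2w(0)=d_2w'(x_2)-a_2w(x_2)=0$; $(0,\bar w)$ is the semi-trivial steady state. For $0\le y_1<y_2\le L$, $d>0$, $a\ge0$, bounded $s$, $\lambda_1(d,a,s,(y_1,y_2))$ is the principal eigenvalue (with positive eigenfunction) of $d\varphi''-a\varphi'+s\varphi=\lambda\varphi$ on $(y_1,y_2)$, $d\varphi'(y_1)-a\varphi(y_1)=\varphi'(y_2)=0$. $(0,\bar w)$ is linearly stable if $\lambda_1(d_1,a_1,r-m\chi_{[0,x_2)}\bar w,(0,L))<0$ and unstable if it is $>0$; it is globally asymptotically stable if all solutions with nonnegative nontrivial initial data converge to it uniformly as $t\to\infty$. For $0<a_1<\sqrt{4d_1r}$: $L^*=2d_1\big(\pi-\arctan\frac{\sqrt{4d_1r-a_1^2}}{a_1}\big)/\sqrt{4d_1r-a_1^2}$;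 $L_1^*=2d_1\arctan\big(\frac{a_1\sqrt{4d_1r-a_1^2}}{2d_1r-a_1^2}\big)/\sqrt{4d_1r-a_1^2}$ if $a_1\le\sqrt{2d_1r}$ and $L_1^*=2d_1\big(\pi+\arctan\frac{a_1\sqrt{4d_1r-a_1^2}}{2d_1r-a_1^2}\big)/\sqrt{4d_1r-a_1^2}$ if $\sqrt{2d_1r}<a_1<\sqrt{4d_1r}$. *)

(* Defs.v *)
From Stdlib Require Import Reals Lra List.
From Coquelicot Require Import Coquelicot.
Open Scope R_scope.

Definition rderiv (f : R -> R) (x l : R) : Prop :=
  filterlim (fun k => (f (x + k) - f x) / k) (at_right 0) (locally l).
Definition lderiv (f : R -> R) (x l : R) : Prop :=
  filterlim (fun k => (f (x + k) - f x) / k) (at_left 0) (locally l).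

Definition chi (x2 x : R) : R :=
  if Rle_dec 0 x then (if Rlt_dec x x2 then 1 else 0) else 0.

Definition cont_on (f : R -> R) (a b : R) : Prop :=
  forall x, a <= x <= b ->
    filterlim f (within (fun y => a <= y <= b) (locally x)) (locally (f x)).

Definition cont_on_strip (u : R -> R -> R) (a b : R) : Prop :=
  forall x t, a <= x <= b -> 0 <= t ->
    filterlim (fun z : R * R => u (fst z) (snd z))
      (within (fun z : R * R => a <= fst z <= b /\ 0 <= snd z) (locally (x, t)))
      (locally (u x t)).

Definition D2 (f : R -> R) (x : R) : R := Derive (Derive f) x.

(* (u,w) is a (classical, piecewise C^2 in x across the interface x = x2)
   solution of the system with initial data (u0,w0).  u x t, w x t. *)
Definition is_solution (d1 d2 r m p q h L a1 a2 x2 : R)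
  (u0 w0 : R -> R) (u w : R -> R -> R) : Prop :=
  cont_on_strip u 0 L /\ cont_on_strip w 0 x2 /\
  (forall x, 0 <= x <= L -> u x 0 = u0 x) /\
  (forall x, 0 <= x <= x2 -> w x 0 = w0 x) /\
  (forall t x, 0 < t -> 0 < x < L ->
     ex_derive (fun y => u y t) x /\ ex_derive (fun s => u x s) t) /\
  (forall t x, 0 < t -> 0 < x < L -> x <> x2 ->
     ex_derive (Derive (fun y => u y t)) x /\
     Derive (fun s => u x s) t =
       d1 * D2 (fun y => u y t) x - a1 * Derive (fun y => u y t) x
       + u x t * (r - u x t - m * chi x2 x * w x t)) /\
  (forall t x, 0 < t -> 0 < x < x2 ->
     ex_derive (fun y => w y t) x /\ ex_derive (Derive (fun y => w y t)) x /\
     ex_derive (fun s => w x s) t /\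
     Derive (fun s => w x s) t =
       d2 * D2 (fun y => w y t) x - a2 * Derive (fun y => w y t) x
       + h - q * w x t - p * u x t * w x t) /\
  (forall t, 0 < t ->
     (exists l, rderiv (fun y => u y t) 0 l /\ d1 * l - a1 * u 0 t = 0) /\
     lderiv (fun y => u y t) L 0 /\
     (exists l, rderiv (fun y => w y t) 0 l /\ d2 * l - a2 * w 0 t = 0) /\
     (exists l, lderiv (fun y => w y t) x2 l /\ d2 * l - a2 * w x2 t = 0)).

Definition is_wbar (d2 a2 h q x2 : R) (wb : R -> R) : Prop :=
  (forall x, 0 <= x <= x2 -> 0 < wb x) /\ cont_on wb 0 x2 /\
  (forall x, 0 < x < x2 ->
     ex_derive wb x /\ ex_derive (Derive wb) x /\
     d2 * D2 wb x - a2 * Derive wb x + h - q * wb x = 0) /\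
  (exists l, rderiv wb 0 l /\ d2 * l - a2 * wb 0 = 0) /\
  (exists l, lderiv wb x2 l /\ d2 * l - a2 * wb x2 = 0).

(* lam is the principal eigenvalue (eigenvalue with a positive eigenfunction) of
   d phi'' - a phi' + s phi = lam phi on (y1,y2), d phi'(y1) - a phi(y1) = phi'(y2) = 0.
   The equation is required off a finite set (s may be discontinuous). *)
Definition is_principal_eig (d a : R) (s : R -> R) (y1 y2 lam : R) : Prop :=
  exists phi : R -> R,
    (forall x, y1 <= x <= y2 -> 0 < phi x) /\ cont_on phi y1 y2 /\
    (forall x, y1 < x < y2 -> ex_derive phi x) /\
    (exists E : list R, forall x, y1 < x < y2 -> ~ In x E ->
        ex_derive (Derive phi) x /\
        d * D2 phi x - a * Derive phi x + s x * phi x = lam * phi x) /\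
    (exists l, rderiv phi y1 l /\ d * l - a * phi y1 = 0) /\
    lderiv phi y2 0.

Definition lambda1_neg (d1 a1 r m L x2 : R) (wb : R -> R) : Prop :=
  exists lam, is_principal_eig d1 a1 (fun x => r - m * chi x2 x * wb x) 0 L lam
              /\ lam < 0.
Definition lambda1_pos (d1 a1 r m L x2 : R) (wb : R -> R) : Prop :=
  exists lam, is_principal_eig d1 a1 (fun x => r - m * chi x2 x * wb x) 0 L lam
              /\ 0 < lam.

Definition lin_stable := lambda1_neg.
Definition lin_unstable := lambda1_pos.

Definition glob_asympt_stable (d1 d2 r m p q h L a1 a2 x2 : R) (wb : R -> R) : Prop :=
  forall (u0 w0 : R -> R) (u w : R -> R -> R),
    cont_on u0 0 L -> cont_on w0 0 x2 ->
    (forall x, 0 <= x <= L -> 0 <= u0 x) -> (exists x, 0 <= x <= L /\ u0 x <> 0) ->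
    (forall x, 0 <= x <= x2 -> 0 <= w0 x) -> (exists x, 0 <= x <= x2 /\ w0 x <> 0) ->
    is_solution d1 d2 r m p q h L a1 a2 x2 u0 w0 u w ->
    forall eps, 0 < eps -> exists T, forall t, T < t ->
      (forall x, 0 <= x <= L -> Rabs (u x t) < eps) /\
      (forall x, 0 <= x <= x2 -> Rabs (w x t - wb x) < eps).

Definition Lstar (d1 a1 r : R) : R :=
  2 * d1 * (PI - atan (sqrt (4 * d1 * r - a1 ^ 2) / a1)) / sqrt (4 * d1 * r - a1 ^ 2).

(* at a1 = sqrt(2 d1 r) the arctan argument is +-infinity; both branches have the
   common limit pi/2 there, which we use. *)
Definition L1star (d1 a1 r : R) : R :=
  let s := sqrt (4 * d1 * r - a1 ^ 2) in
  if Rlt_dec a1 (sqrt (2 * d1 * r)) then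
    2 * d1 * atan (a1 * s / (2 * d1 * r - a1 ^ 2)) / s
  else if Req_EM_T a1 (sqrt (2 * d1 * r)) then
    2 * d1 * (PI / 2) / s
  else
    2 * d1 * (PI + atan (a1 * s / (2 * d1 * r - a1 ^ 2))) / s.

(* Main.v *)
(** Write [lambda(beta)] for the principal eigenvalue of
    [d1 f'' - a1 f' + (r - chi beta) f = lambda f] with the given boundary conditions.  Such an
    eigenpair is obtained by shooting from [x = 0]: the infimum of the parameters for which the
    solution stays positive with positive slope at [L] has slope exactly [0] there.

    If [d1 f'' - a1 f' = k f] and [d1 g'' - a1 g' = l g], the weighted Wronskian
    [e^(-a1 x/d1) (f' g - f g')] has derivative [e^(-a1 x/d1) (k - l) f g / d1].  Comparing two
    eigenfunctions gives strict monotonicity of [lambda] in [beta], so that the thresholds are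
    suprema; comparing an eigenfunction with an explicit solution [e^(a1 x/(2 d1)) cos(...)] gives the
    sign of [lambda(0)] through [L1star], and the effect of the protection zone through [Lstar].
    Both lengths are expressed with the angle [atan (a1 / sqrt (4 d1 r - a1^2))].

    If [lambda(0) < 0] with eigenfunction [f], a parabolic minimum principle gives
    [0 <= u <= C e^(lambda t) f], and then [|w - wbar| <= C' e^(-c t) e^(a2 x/d2)], because
    [e^(a2 x/d2)] is a zero-flux solution of [d2 v'' - a2 v' = 0].  The same principle, applied to
    steady states, bounds and compares the functions [wbar]. *)

Require Import Defs.
From Stdlib Require Import Reals Lra Lia List Classical ClassicalEpsilon FunctionalExtensionality.
From Coquelicot Require Import Coquelicot.
Open Scope R_scope.

(** * One-sided derivatives and the Wronskian *)

Lemma is_derive_eq (f : R -> R) (x l l' : R) :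
  is_derive f x l -> l = l' -> is_derive f x l'.
Proof. intros H <-; exact H. Qed.

Lemma is_derive_cont (f : R -> R) (x l : R) : is_derive f x l -> continuous f x.
Proof. intro H; apply (ex_derive_continuous f x); exists l; exact H. Qed.

Lemma nondecreasing_of_deriv (f df : R -> R) (a b : R) :
  a <= b -> (forall x, a <= x <= b -> continuous f x) ->
  (forall x, a < x < b -> is_derive f x (df x) /\ 0 <= df x) -> f a <= f b.
Proof.
  intros Hab Hc Hd.
  (* [MVT_gen] returns a point of the closed interval, so [df] is given a harmless value at the ends. *)
  pose (dg := fun x => if Rlt_dec a x then if Rlt_dec x b then df x else 1 else 1).
  destruct (MVT_gen f a b dg) as [c [Hcab Hm]].
  - rewrite Rmin_left, Rmax_right by lra. intros x Hx. unfold dg.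
    destruct (Rlt_dec a x); [|lra]. destruct (Rlt_dec x b); [|lra]. apply Hd; lra.
  - rewrite Rmin_left, Rmax_right by lra. intros x Hx.
    apply continuity_pt_filterlim, Hc; lra.
  - assert (0 <= dg c).
    { unfold dg. destruct (Rlt_dec a c); [|lra]. destruct (Rlt_dec c b); [|lra].
      apply Hd; lra. }
    nra.
Qed.

Lemma increasing_of_deriv (f df : R -> R) (a b : R) :
  a < b -> (forall x, a <= x <= b -> continuous f x) ->
  (forall x, a < x < b -> is_derive f x (df x) /\ 0 < df x) -> f a < f b.
Proof.
  intros Hab Hc Hd.
  pose (dg := fun x => if Rlt_dec a x then if Rlt_dec x b then df x else 1 else 1).
  destruct (MVT_gen f a b dg) as [c [Hcab Hm]].
  - rewrite Rmin_left, Rmax_right by lra. intros x Hx. unfold dg.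
    destruct (Rlt_dec a x); [|lra]. destruct (Rlt_dec x b); [|lra]. apply Hd; lra.
  - rewrite Rmin_left, Rmax_right by lra. intros x Hx.
    apply continuity_pt_filterlim, Hc; lra.
  - assert (0 < dg c).
    { unfold dg. destruct (Rlt_dec a c); [|lra]. destruct (Rlt_dec c b); [|lra].
      apply Hd; lra. }
    nra.
Qed.

Lemma nondecreasing_off_point (f df : R -> R) (c a b : R) :
  a <= b -> (forall x, a <= x <= b -> continuous f x) ->
  (forall x, a < x < b -> x <> c -> is_derive f x (df x) /\ 0 <= df x) -> f a <= f b.
Proof.
  intros Hab Hc Hd.
  destruct (Rlt_dec a c) as [H1|H1]; [destruct (Rlt_dec c b) as [H2|H2]|].
  - apply Rle_trans with (f c); apply nondecreasing_of_deriv with df; try lra;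
      intros x Hx; try (apply Hc; lra); apply Hd; lra.
  - apply nondecreasing_of_deriv with df; auto. intros x Hx; apply Hd; lra.
  - apply nondecreasing_of_deriv with df; auto. intros x Hx; apply Hd; lra.
Qed.

Lemma increasing_off_point (f df : R -> R) (c a b : R) :
  a < b -> (forall x, a <= x <= b -> continuous f x) ->
  (forall x, a < x < b -> x <> c -> is_derive f x (df x) /\ 0 < df x) -> f a < f b.
Proof.
  intros Hab Hc Hd.
  destruct (Rlt_dec a c) as [H1|H1]; [destruct (Rlt_dec c b) as [H2|H2]|].
  - apply Rlt_trans with (f c); apply increasing_of_deriv with df; try lra;
      intros x Hx; try (apply Hc; lra); apply Hd; lra.
  - apply increasing_of_deriv with df; auto. intros x Hx; apply Hd; lra.
  - apply increasing_of_deriv with df; auto. intros x Hx; apply Hd; lra.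
Qed.

Definition sided_deriv (F : (R -> Prop) -> Prop) (f : R -> R) (x l : R) : Prop :=
  filterlim (fun k => (f (x + k) - f x) / k) F (locally l).

Lemma sided_deriv_lin (F : (R -> Prop) -> Prop) {FF : Filter F}
  (f g : R -> R) (x lf lg p q : R) :
  sided_deriv F f x lf -> sided_deriv F g x lg ->
  sided_deriv F (fun y => p * f y + q * g y) x (p * lf + q * lg).
Proof.
  intros Hf Hg. unfold sided_deriv in *.
  apply filterlim_ext with
    (fun k => plus (scal p ((f (x + k) - f x) / k)) (scal q ((g (x + k) - g x) / k))).
  - intros k. unfold plus, scal; simpl; unfold mult; simpl. unfold Rdiv. ring.
  - apply (filterlim_comp_2 (G := locally (scal p lf)) (H := locally (scal q lg))).
    + eapply filterlim_comp; [apply Hf|]. apply (filterlim_scal_r p lf).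
    + eapply filterlim_comp; [apply Hg|]. apply (filterlim_scal_r q lg).
    + apply (filterlim_plus (scal p lf) (scal q lg)).
Qed.

Lemma is_derive_quotient (f : R -> R) (x l : R) :
  is_derive f x l ->
  forall eps, 0 < eps -> exists del, 0 < del /\
    forall k, k <> 0 -> Rabs k < del -> Rabs ((f (x + k) - f x) / k - l) < eps.
Proof.
  intros H eps He. apply is_derive_Reals in H.
  destruct (H eps He) as [del Hd]. exists del. split; [apply cond_pos|]. exact Hd.
Qed.

Lemma is_derive_rderiv (f : R -> R) (x l : R) : is_derive f x l -> rderiv f x l.
Proof.
  intros H P [eps HP].
  destruct (is_derive_quotient f x l H eps (cond_pos eps)) as [del [Hd Hq]].
  exists (mkposreal del Hd). intros k Hk H0. apply HP.
  unfold ball in *; simpl in *; unfold AbsRing_ball, abs, minus, plus, opp in *; simpl in *.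
  apply Hq; [lra|]. replace k with (k + - 0) by ring. exact Hk.
Qed.

Lemma is_derive_lderiv (f : R -> R) (x l : R) : is_derive f x l -> lderiv f x l.
Proof.
  intros H P [eps HP].
  destruct (is_derive_quotient f x l H eps (cond_pos eps)) as [del [Hd Hq]].
  exists (mkposreal del Hd). intros k Hk H0. apply HP.
  unfold ball in *; simpl in *; unfold AbsRing_ball, abs, minus, plus, opp in *; simpl in *.
  apply Hq; [lra|]. replace k with (k + - 0) by ring. exact Hk.
Qed.

Lemma rderiv_min (f : R -> R) (x l del : R) :
  0 < del -> rderiv f x l -> (forall y, x < y < x + del -> f x <= f y) -> 0 <= l.
Proof.
  intros Hdel H Hm. destruct (Rle_dec 0 l) as [|Hl]; [assumption|exfalso].
  assert (He : 0 < - l) by lra.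
  destruct (H (fun z => ball l (mkposreal _ He) z)) as [eta Heta].
  { exists (mkposreal _ He). intros z Hz; exact Hz. }
  pose (k := Rmin (eta / 2) (del / 2)).
  assert (Hk : 0 < k) by (unfold k; apply Rmin_glb_lt; [destruct eta; simpl; lra | lra]).
  assert (k <= eta / 2) by apply Rmin_l. assert (k <= del / 2) by apply Rmin_r.
  specialize (Heta k). unfold ball in Heta; simpl in Heta.
  unfold AbsRing_ball, abs, minus, plus, opp in Heta; simpl in Heta.
  assert (Hb : Rabs (k + - 0) < eta).
  { rewrite Rabs_pos_eq by lra. destruct eta as [e Hpe]; simpl in *; lra. }
  specialize (Heta Hb Hk). apply Rabs_def2 in Heta.
  assert (0 <= (f (x + k) - f x) / k).
  { apply Rdiv_le_0_compat; [|lra]. specialize (Hm (x + k)). lra. }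
  lra.
Qed.

Lemma lderiv_min (f : R -> R) (x l del : R) :
  0 < del -> lderiv f x l -> (forall y, x - del < y < x -> f x <= f y) -> l <= 0.
Proof.
  intros Hdel H Hm. destruct (Rle_dec l 0) as [|Hl]; [assumption|exfalso].
  assert (He : 0 < l) by lra.
  destruct (H (fun z => ball l (mkposreal _ He) z)) as [eta Heta].
  { exists (mkposreal _ He). intros z Hz; exact Hz. }
  pose (k := Rmin (eta / 2) (del / 2)).
  assert (Hk : 0 < k) by (unfold k; apply Rmin_glb_lt; [destruct eta; simpl; lra | lra]).
  assert (k <= eta / 2) by apply Rmin_l. assert (k <= del / 2) by apply Rmin_r.
  specialize (Heta (- k)). unfold ball in Heta; simpl in Heta.
  unfold AbsRing_ball, abs, minus, plus, opp in Heta; simpl in Heta.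
  assert (Hb : Rabs (- k + - 0) < eta).
  { replace (- k + - 0) with (- k) by ring. rewrite Rabs_Ropp, Rabs_pos_eq by lra.
    destruct eta as [e Hpe]; simpl in *; lra. }
  assert (Hk' : - k < 0) by lra.
  specialize (Heta Hb Hk'). apply Rabs_def2 in Heta.
  assert (0 <= (f (x + - k) - f x) / k).
  { apply Rdiv_le_0_compat; [|lra]. specialize (Hm (x + - k)). lra. }
  replace ((f (x + - k) - f x) / - k) with (- ((f (x + - k) - f x) / k)) in Heta by (field; lra).
  lra.
Qed.

Definition has_d2 (f : R -> R) (x f1 f2 : R) : Prop :=
  exists g : R -> R, locally x (fun y => is_derive f y (g y)) /\ g x = f1 /\ is_derive g x f2.

Lemma has_d2_global (f g : R -> R) (x f2 : R) :
  (forall y, is_derive f y (g y)) -> is_derive g x f2 -> has_d2 f x (g x) f2.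
Proof.
  intros H H2. exists g. split; [|split; [reflexivity|exact H2]]. apply filter_forall, H.
Qed.

Lemma has_d2_lin (f g : R -> R) (x f1 f2 g1 g2 p q : R) :
  has_d2 f x f1 f2 -> has_d2 g x g1 g2 ->
  has_d2 (fun y => p * f y + q * g y) x (p * f1 + q * g1) (p * f2 + q * g2).
Proof.
  intros (F & HF & HF1 & HF2) (G & HG & HG1 & HG2).
  exists (fun y => p * F y + q * G y). split; [|split].
  - apply filter_imp with (2 := filter_and _ _ HF HG). intros y [A B].
    apply (is_derive_plus (fun y => p * f y) (fun y => q * g y) y).
    + apply (is_derive_scal f y p _ A).
    + apply (is_derive_scal g y q _ B).
  - now rewrite HF1, HG1.
  - apply (is_derive_plus (fun y => p * F y) (fun y => q * G y) x).
    + apply (is_derive_scal F x p _ HF2).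
    + apply (is_derive_scal G x q _ HG2).
Qed.

Lemma has_d2_Derive (f : R -> R) (a b x : R) :
  a < x < b -> (forall y, a < y < b -> ex_derive f y) -> ex_derive (Derive f) x ->
  has_d2 f x (Derive f x) (D2 f x).
Proof.
  intros Hx H H2. exists (Derive f). split; [|split; [reflexivity|]].
  - assert (Hd : 0 < Rmin (x - a) (b - x)) by (apply Rmin_glb_lt; lra).
    exists (mkposreal _ Hd). intros y Hy. apply Derive_correct, H.
    unfold ball in Hy; simpl in Hy; unfold AbsRing_ball, abs, minus, plus, opp in Hy; simpl in Hy.
    apply Rabs_def2 in Hy.
    assert (Rmin (x - a) (b - x) <= x - a) by apply Rmin_l.
    assert (Rmin (x - a) (b - x) <= b - x) by apply Rmin_r. lra.
  - apply Derive_correct, H2.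
Qed.

Lemma has_d2_min (f : R -> R) (x f1 f2 del : R) :
  0 < del -> has_d2 f x f1 f2 -> (forall y, x - del < y < x + del -> f x <= f y) ->
  f1 = 0 /\ 0 <= f2.
Proof.
  intros Hdel (g & [e1 Hg] & H1 & H2) Hm.
  assert (Hx : is_derive f x (g x)) by (apply Hg, ball_center).
  assert (H0 : f1 = 0).
  { rewrite <- H1. apply Rle_antisym.
    - apply (lderiv_min f x _ del Hdel); [apply is_derive_lderiv, Hx|].
      intros y Hy; apply Hm; lra.
    - apply (rderiv_min f x _ del Hdel); [apply is_derive_rderiv, Hx|].
      intros y Hy; apply Hm; lra. }
  split; [exact H0|].
  destruct (Rle_dec 0 f2) as [|Hn]; [assumption|exfalso].
  assert (He : 0 < - f2) by lra.
  destruct (is_derive_quotient g x f2 H2 (- f2) He) as [e2 [He2 Hq]].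
  pose (k := Rmin (e1 / 2) (Rmin (e2 / 2) (del / 2))).
  assert (k <= e1 / 2) by apply Rmin_l.
  assert (k <= e2 / 2) by (eapply Rle_trans; [apply Rmin_r|apply Rmin_l]).
  assert (k <= del / 2) by (eapply Rle_trans; [apply Rmin_r|apply Rmin_r]).
  assert (Hk : 0 < k).
  { unfold k. destruct e1 as [e1 He1]; simpl in *. repeat apply Rmin_glb_lt; lra. }
  assert (Hin : forall y, x <= y <= x + k -> is_derive f y (g y)).
  { intros y Hy. apply Hg. unfold ball; simpl; unfold AbsRing_ball, abs, minus, plus, opp; simpl.
    rewrite Rabs_pos_eq by lra. destruct e1 as [e1 He1]; simpl in *. lra. }
  assert (Hlt : - f x < - f (x + k)).
  { apply (increasing_of_deriv (fun y => - f y) (fun y => - g y)); [lra| |].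
    - intros y Hy. apply (continuous_opp f y). apply is_derive_cont with (g y), Hin, Hy.
    - intros y Hy. split; [apply (is_derive_opp f y), Hin; lra|].
      assert (Hy2 : y - x <> 0) by lra.
      assert (Hy3 : Rabs (y - x) < e2) by (rewrite Rabs_pos_eq; lra).
      specialize (Hq _ Hy2 Hy3). apply Rabs_def2 in Hq.
      replace (x + (y - x)) with y in Hq by ring. rewrite H1, H0 in Hq.
      assert ((g y - 0) / (y - x) < 0) by lra.
      assert (g y = (g y - 0) / (y - x) * (y - x)) by (field; lra).
      nra. }
  specialize (Hm (x + k)). lra.
Qed.

Definition wronskian (b : R) (f f1 g g1 : R -> R) (x : R) : R :=
  exp (- b * x) * (f1 x * g x - f x * g1 x).

Definition is_C1 (f f1 : R -> R) : Prop :=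
  forall x, is_derive f x (f1 x) /\ continuous f1 x.

(* [d f'' - a f' = k f] on the interval, except possibly at the point [c]. *)
Definition solves (d a : R) (k : R -> R) (c y1 y2 : R) (f f1 : R -> R) : Prop :=
  forall x, y1 < x < y2 -> x <> c -> is_derive f1 x ((a * f1 x + k x * f x) / d).

Section Wronskian.
Variables (d a c y1 y2 : R) (kf kg f f1 g g1 : R -> R).
Hypotheses (Hd : 0 < d) (Cf : is_C1 f f1) (Cg : is_C1 g g1)
  (Sf : solves d a kf c y1 y2 f f1) (Sg : solves d a kg c y1 y2 g g1).

Lemma wronskian_continuous x : continuous (wronskian (a / d) f f1 g g1) x.
Proof.
  unfold wronskian.
  apply (continuous_mult (fun x => exp (- (a / d) * x))).
  - eapply is_derive_cont. auto_derive; trivial.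
  - apply (continuous_minus (fun x => f1 x * g x) (fun x => f x * g1 x)).
    + apply (continuous_mult f1 g); [apply Cf|]. eapply is_derive_cont; apply Cg.
    + apply (continuous_mult f g1); [|apply Cg]. eapply is_derive_cont; apply Cf.
Qed.

Lemma wronskian_is_derive x : y1 < x < y2 -> x <> c ->
  is_derive (wronskian (a / d) f f1 g g1) x
    (exp (- (a / d) * x) / d * ((kf x - kg x) * (f x * g x))).
Proof.
  intros Hx Hc. unfold wronskian.
  pose proof (Sf x Hx Hc) as A1. pose proof (Sg x Hx Hc) as A2.
  pose proof (proj1 (Cf x)) as A3. pose proof (proj1 (Cg x)) as A4.
  eapply is_derive_eq.
  - auto_derive.
    + repeat split; eexists; eassumption.
    + reflexivity.
  - change (fun x0 => f1 x0) with f1; change (fun x0 => g1 x0) with g1;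
    change (fun x0 => f x0) with f; change (fun x0 => g x0) with g.
    rewrite (is_derive_unique f1 x _ A1), (is_derive_unique g1 x _ A2),
      (is_derive_unique f x _ A3), (is_derive_unique g x _ A4).
    field; lra.
Qed.

Lemma wronskian_nondecreasing :
  y1 <= y2 -> (forall x, y1 < x < y2 -> x <> c -> 0 <= (kf x - kg x) * (f x * g x)) ->
  wronskian (a / d) f f1 g g1 y1 <= wronskian (a / d) f f1 g g1 y2.
Proof.
  intros H12 Hk. eapply nondecreasing_off_point with (c := c); [exact H12| |].
  - intros x _; apply wronskian_continuous.
  - intros x Hx Hc. split; [apply wronskian_is_derive; assumption|].
    apply Rmult_le_pos; [|apply Hk; assumption].
    apply Rlt_le, Rdiv_lt_0_compat; [apply exp_pos|exact Hd].
Qed.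

Lemma wronskian_increasing :
  y1 < y2 -> (forall x, y1 < x < y2 -> x <> c -> 0 < (kf x - kg x) * (f x * g x)) ->
  wronskian (a / d) f f1 g g1 y1 < wronskian (a / d) f f1 g g1 y2.
Proof.
  intros H12 Hk. eapply increasing_off_point with (c := c); [exact H12| |].
  - intros x _; apply wronskian_continuous.
  - intros x Hx Hc. split; [apply wronskian_is_derive; assumption|].
    apply Rmult_lt_0_compat; [|apply Hk; assumption].
    apply Rdiv_lt_0_compat; [apply exp_pos|exact Hd].
Qed.
End Wronskian.

(** * A parabolic minimum principle *)

Lemma rectangle_compact (a b c d : R) (Q : R -> R -> R -> Prop) :
  (forall e e' x t, 0 < e <= e' -> Q e' x t -> Q e x t) ->
  (forall x t, a <= x <= b -> c <= t <= d -> exists e, 0 < e /\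
     forall y s, a <= y <= b -> c <= s <= d -> Rabs (y - x) < e -> Rabs (s - t) < e -> Q e y s) ->
  exists e, 0 < e /\ forall x t, a <= x <= b -> c <= t <= d -> Q e x t.
Proof.
  intros Hmono Hloc.
  assert (Hex : forall x t, exists e : posreal, a <= x <= b -> c <= t <= d ->
     forall y s, a <= y <= b -> c <= s <= d -> Rabs (y - x) < e -> Rabs (s - t) < e -> Q e y s).
  { intros x t. destruct (classic (a <= x <= b /\ c <= t <= d)) as [[Hx Ht]|Hn].
    - destruct (Hloc x t Hx Ht) as [e [He H]]. exists (mkposreal e He). intros _ _; exact H.
    - exists (mkposreal 1 Rlt_0_1). intros; exfalso; apply Hn; split; assumption. }
  pose (del := fun x t => proj1_sig (constructive_indefinite_description _ (Hex x t))).
  destruct (compactness_value_2d a b c d del) as [e He].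
  exists e. split; [apply cond_pos|]. intros x t Hx Ht.
  destruct (NNPP _ (He x t Hx Ht)) as (u & v & Hu & Hv & H1 & H2 & H3).
  apply Hmono with (del u v); [split; [apply cond_pos|exact H3]|].
  exact (proj2_sig (constructive_indefinite_description _ (Hex u v)) Hu Hv x t Hx Ht H1 H2).
Qed.

Definition continuous_on_rectangle (F : R -> R -> R) (a b c d : R) : Prop :=
  forall x t, a <= x <= b -> c <= t <= d ->
    filterlim (fun z : R * R => F (fst z) (snd z))
      (within (fun z : R * R => a <= fst z <= b /\ c <= snd z <= d) (locally (x, t)))
      (locally (F x t)).

Lemma rectangle_min (F : R -> R -> R) (a b c d : R) :
  a <= b -> c <= d -> continuous_on_rectangle F a b c d ->
  exists x0 t0, a <= x0 <= b /\ c <= t0 <= d /\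
    forall x t, a <= x <= b -> c <= t <= d -> F x0 t0 <= F x t.
Proof.
  intros Hab Hcd HF.
  assert (Hloc : forall x t, a <= x <= b -> c <= t <= d -> forall e, 0 < e ->
    exists del, 0 < del /\ forall y s, a <= y <= b -> c <= s <= d ->
      Rabs (y - x) < del -> Rabs (s - t) < del -> Rabs (F y s - F x t) < e).
  { intros x t Hx Ht e He.
    destruct (HF x t Hx Ht (fun z => Rabs (z - F x t) < e)) as [del Hdel].
    { exists (mkposreal e He). intros z Hz. exact Hz. }
    exists del. split; [apply cond_pos|]. intros y s Hy Hs H1 H2.
    apply (Hdel (y, s)); [split; assumption|split; assumption]. }
  pose (E := fun y => exists x t, a <= x <= b /\ c <= t <= d /\ y = - F x t).
  assert (Hbd : bound E).
  { destruct (rectangle_compact a b c d (fun e x t => - / e <= F x t)) as [e [He Hge]].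
    - intros e e' x t Hee H. assert (/ e' <= / e) by (apply Rinv_le_contravar; lra). lra.
    - intros x t Hx Ht. destruct (Hloc x t Hx Ht 1 Rlt_0_1) as [del [Hd Hdl]].
      pose (q := / (1 + Rabs (F x t))).
      assert (Hq : 0 < q) by (apply Rinv_0_lt_compat; pose proof (Rabs_pos (F x t)); lra).
      exists (Rmin del q). split; [apply Rmin_glb_lt; assumption|]. intros y s Hy Hs H1 H2.
      pose proof (Rmin_l del q).
      assert (H3 : Rabs (F y s - F x t) < 1) by (apply Hdl; try assumption; lra).
      apply Rabs_def2 in H3.
      assert (H4 : / q <= / Rmin del q).
      { apply Rinv_le_contravar; [apply Rmin_glb_lt; assumption|apply Rmin_r]. }
      unfold q in H4 at 1. rewrite Rinv_inv in H4.
      pose proof (Rle_abs (- F x t)) as H5. rewrite Rabs_Ropp in H5. lra.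
    - exists (/ e). intros y (x & t & Hx & Ht & ->). specialize (Hge x t Hx Ht). lra. }
  destruct (completeness E Hbd) as [M [HM1 HM2]].
  { exists (- F a c), a, c. repeat split; lra. }
  destruct (classic (exists x0 t0, a <= x0 <= b /\ c <= t0 <= d /\ F x0 t0 <= - M))
    as [(x0 & t0 & Hx0 & Ht0 & HF0)|Hno].
  - exists x0, t0. repeat split; try lra. intros x t Hx Ht.
    assert (- F x t <= M) by (apply HM1; exists x, t; auto). lra.
  - (* Otherwise [F] is bounded away from its infimum. *)
    destruct (rectangle_compact a b c d (fun e x t => - M + e <= F x t)) as [e [He Hge]].
    + intros e e' x t Hee H. lra.
    + intros x t Hx Ht.
      assert (Hgx : - M < F x t).
      { apply Rnot_le_lt. intro H. apply Hno. exists x, t. auto. }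
      assert (Hh : 0 < (F x t + M) / 2) by lra.
      destruct (Hloc x t Hx Ht _ Hh) as [del [Hd Hdl]].
      exists (Rmin del ((F x t + M) / 2)). split; [apply Rmin_glb_lt; assumption|].
      intros y s Hy Hs H1 H2.
      pose proof (Rmin_l del ((F x t + M) / 2)). pose proof (Rmin_r del ((F x t + M) / 2)).
      assert (H3 : Rabs (F y s - F x t) < (F x t + M) / 2) by (apply Hdl; try assumption; lra).
      apply Rabs_def2 in H3. lra.
    + assert (M <= M - e); [|lra].
      apply HM2. intros y (x & t & Hx & Ht & ->). specialize (Hge x t Hx Ht). lra.
Qed.

Lemma strip_rectangle (z : R -> R -> R) (a b T : R) :
  cont_on_strip z a b -> continuous_on_rectangle z a b 0 T.
Proof.
  intros H x t Hx Ht P HP. specialize (H x t Hx (proj1 Ht) P HP).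
  unfold filtermap, within in *. apply filter_imp with (2 := H).
  intros y Hy [H1 H2]. apply Hy. split; [exact H1|lra].
Qed.

Lemma strip_bound (z : R -> R -> R) (a b T : R) :
  a <= b -> 0 <= T -> cont_on_strip z a b ->
  exists B, 0 < B /\ forall x t, a <= x <= b -> 0 <= t <= T -> - B <= z x t.
Proof.
  intros Hab HT H.
  destruct (rectangle_min z a b 0 T Hab HT (strip_rectangle z a b T H)) as (x0 & t0 & _ & _ & Hm).
  exists (Rabs (z x0 t0) + 1). split; [pose proof (Rabs_pos (z x0 t0)); lra|].
  intros x t Hx Ht. specialize (Hm x t Hx Ht).
  pose proof (Rle_abs (- z x0 t0)) as H5. rewrite Rabs_Ropp in H5. lra.
Qed.

(* The weight has a concave kink at [xi], so that [z + mu e^(Ct) weight] cannot have a minimum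
   there; hence nothing but differentiability of [z] is needed at the interface. *)
Definition kink_weight (A l xi x : R) : R := exp (A * (x ^ 2 / l - x) - Rabs (x - xi)).

(* [kink_weight] is the branch [e = 1] on the left of [xi] and [e = -1] on its right. *)
Definition kink_branch (A l xi e x : R) : R := exp (A * (x ^ 2 / l - x) + e * (x - xi)).

Lemma kink_branch_is_derive (A l xi e x : R) : 0 < l ->
  is_derive (kink_branch A l xi e) x ((A * (2 * x / l - 1) + e) * kink_branch A l xi e x).
Proof.
  intros Hl. unfold kink_branch. auto_derive; [trivial|]. unfold Rminus, Rdiv; simpl; ring_simplify.
  rewrite ?Rmult_1_r. ring.
Qed.

Lemma kink_branch_has_d2 (A l xi e x : R) : 0 < l ->
  has_d2 (kink_branch A l xi e) x ((A * (2 * x / l - 1) + e) * kink_branch A l xi e x)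
   ((2 * A / l + (A * (2 * x / l - 1) + e) ^ 2) * kink_branch A l xi e x).
Proof.
  intros Hl.
  apply (has_d2_global _ (fun y => (A * (2 * y / l - 1) + e) * kink_branch A l xi e y)).
  - intros y; apply kink_branch_is_derive, Hl.
  - eapply is_derive_eq.
    + apply (is_derive_mult (fun y => A * (2 * y / l - 1) + e) (kink_branch A l xi e)).
      * auto_derive; trivial.
      * apply kink_branch_is_derive, Hl.
      * intros; apply Rmult_comm.
    + unfold plus, mult; simpl. field. lra.
Qed.

Lemma kink_weight_left (A l xi x : R) : x <= xi -> kink_weight A l xi x = kink_branch A l xi 1 x.
Proof.
  intros H. unfold kink_weight, kink_branch. rewrite Rabs_left1 by lra. f_equal; ring.
Qed.

Lemma kink_weight_right (A l xi x : R) :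
  xi <= x -> kink_weight A l xi x = kink_branch A l xi (-1) x.
Proof.
  intros H. unfold kink_weight, kink_branch. rewrite Rabs_pos_eq by lra. f_equal; ring.
Qed.

Lemma kink_weight_continuous (A l xi x : R) : 0 < l -> continuous (kink_weight A l xi) x.
Proof.
  intros Hl. unfold kink_weight. apply continuous_comp; [|eapply is_derive_cont; auto_derive; trivial].
  apply (continuous_minus (fun x => A * (x ^ 2 / l - x)) (fun x => Rabs (x - xi))).
  - eapply is_derive_cont. auto_derive; trivial.
  - apply (continuous_comp (fun x => x - xi) Rabs); [|apply continuous_Rabs].
    eapply is_derive_cont. auto_derive; trivial.
Qed.

Lemma parabolic_min (l T d a K b0 b1 xi : R) (z : R -> R -> R) :
  0 < l -> 0 < d -> 0 < xi ->
  cont_on_strip z 0 l ->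
  (forall x, 0 <= x <= l -> 0 <= z x 0) ->
  (forall t, 0 < t <= T -> 0 < xi < l -> ex_derive (fun y => z y t) xi) ->
  (forall t x, 0 < t <= T -> 0 < x < l -> x <> xi -> exists zx zxx zt,
     has_d2 (fun y => z y t) x zx zxx /\ is_derive (fun s => z x s) t zt /\
     (z x t < 0 -> d * zxx - a * zx + K * z x t <= zt)) ->
  (forall t, 0 < t <= T -> exists k, rderiv (fun y => z y t) 0 k /\ d * k <= b0 * z 0 t) ->
  (forall t, 0 < t <= T -> exists k, lderiv (fun y => z y t) l k /\ b1 * z l t <= d * k) ->
  forall x t, 0 <= x <= l -> 0 <= t <= T -> 0 <= z x t.
Proof.
  intros Hl Hd Hxi Hc H0 Hix Hpde Hb0 Hb1.
  assert (Hmain : forall x t, 0 <= x <= l -> 0 <= t <= T -> 0 <= T -> 0 <= z x t);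
    [|intros x t Hx Ht; apply Hmain; lra].
  pose (A := 2 + Rabs (b0 / d) + Rabs (b1 / d)).
  pose (C := d * (2 * A / l + (A + 1) ^ 2) + Rabs a * (A + 1) + K + 1).
  pose (g := kink_weight A l xi).
  assert (Hg : forall x, 0 < g x) by (intro; apply exp_pos).
  assert (HA0 : Rabs (b0 / d) + 2 <= A) by (unfold A; pose proof (Rabs_pos (b1 / d)); lra).
  assert (HA1 : Rabs (b1 / d) + 2 <= A) by (unfold A; pose proof (Rabs_pos (b0 / d)); lra).
  assert (HA : 2 <= A) by (pose proof (Rabs_pos (b0 / d)); lra).
  intros x t Hx Ht HT.
  destruct (rectangle_min (fun x t => z x t * (exp (- C * t) / g x)) 0 l 0 T)
    as (x0 & t0 & Hx0 & Ht0 & Hmin); [lra|exact HT| |].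
  { intros y s Hy Hs.
    apply (filterlim_comp_2 (G := locally (z y s)) (H := locally (exp (- C * s) / g y))).
    - apply (strip_rectangle z 0 l T Hc y s Hy Hs).
    - eapply filterlim_filter_le_1; [apply filter_le_within|].
      change (continuous (fun p : R * R => exp (- C * snd p) / g (fst p)) (y, s)).
      apply (continuous_mult (fun p : R * R => exp (- C * snd p)) (fun p : R * R => / g (fst p))).
      + apply (continuous_comp snd (fun v => exp (- C * v))); [apply continuous_snd|].
        eapply is_derive_cont; auto_derive; trivial.
      + apply (continuous_comp fst (fun v => / g v)); [apply continuous_fst|].
        apply continuous_comp; [apply kink_weight_continuous, Hl|].
        apply (continuous_Rinv (g y)). specialize (Hg y); simpl; lra.
    - apply (filterlim_mult (z y s) (exp (- C * s) / g y)). }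
  destruct (Rle_dec 0 (z x0 t0 * (exp (- C * t0) / g x0))) as [Hpos|Hneg].
  { specialize (Hmin x t Hx Ht).
    assert (0 < exp (- C * t) / g x) by (apply Rdiv_lt_0_compat; [apply exp_pos|apply Hg]).
    nra. }
  exfalso.
  pose (mu := - (z x0 t0 * (exp (- C * t0) / g x0))).
  assert (Hmu : 0 < mu) by (unfold mu; lra).
  assert (HZ : forall y s, 0 <= y <= l -> 0 <= s <= T -> 0 <= z y s + mu * exp (C * s) * g y).
  { intros y s Hy Hs. specialize (Hmin y s Hy Hs). fold mu in Hmin.
    assert (Hm : - mu <= z y s * (exp (- C * s) / g y)) by (unfold mu; lra).
    assert (HE : z y s + mu * exp (C * s) * g y
       = (z y s * (exp (- C * s) / g y) + mu) * (exp (C * s) * g y)).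
    { replace (- C * s) with (- (C * s)) by ring. rewrite exp_Ropp. field.
      pose proof (Hg y); pose proof (exp_pos (C * s)); split; lra. }
    rewrite HE. apply Rmult_le_pos; [lra|]. apply Rmult_le_pos; apply Rlt_le; [apply exp_pos|apply Hg]. }
  assert (HZ0 : z x0 t0 = - (mu * exp (C * t0) * g x0)).
  { unfold mu. replace (- C * t0) with (- (C * t0)) by ring. rewrite exp_Ropp. field.
    pose proof (Hg x0); pose proof (exp_pos (C * t0)); split; lra. }
  pose (M := mu * exp (C * t0)).
  assert (HM : 0 < M) by (apply Rmult_lt_0_compat; [exact Hmu|apply exp_pos]).
  fold M in HZ0.
  assert (Hz0 : z x0 t0 < 0) by (rewrite HZ0; pose proof (Hg x0); nra).
  assert (Ht0' : 0 < t0 <= T).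
  { split; [|lra]. destruct (Rle_lt_or_eq_dec 0 t0 (proj1 Ht0)) as [|E]; [assumption|].
    rewrite <- E in Hz0. specialize (H0 x0 Hx0). lra. }
  assert (Hbr : forall e y, 0 <= y <= l -> kink_weight A l xi y = kink_branch A l xi e y ->
      0 <= z y t0 + M * kink_branch A l xi e y).
  { intros e y Hy <-. unfold M. apply HZ; lra. }
  assert (Hbr0 : forall e, kink_weight A l xi x0 = kink_branch A l xi e x0 ->
      z x0 t0 + M * kink_branch A l xi e x0 = 0).
  { intros e <-. rewrite HZ0. unfold g; ring. }
  assert (Hsr : forall e k, rderiv (fun y => z y t0) x0 k ->
     rderiv (fun y => z y t0 + M * kink_branch A l xi e y) x0
       (k + M * ((A * (2 * x0 / l - 1) + e) * kink_branch A l xi e x0))).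
  { intros e k Hk.
    apply filterlim_ext with (fun k => ((1 * z (x0 + k) t0 + M * kink_branch A l xi e (x0 + k)) -
       (1 * z x0 t0 + M * kink_branch A l xi e x0)) / k).
    { intros v; rewrite !Rmult_1_l; reflexivity. }
    rewrite <- (Rmult_1_l k).
    apply (sided_deriv_lin (at_right 0) (fun y => z y t0) (kink_branch A l xi e)); [exact Hk|].
    apply is_derive_rderiv, kink_branch_is_derive, Hl. }
  assert (Hsl : forall e k, lderiv (fun y => z y t0) x0 k ->
     lderiv (fun y => z y t0 + M * kink_branch A l xi e y) x0
       (k + M * ((A * (2 * x0 / l - 1) + e) * kink_branch A l xi e x0))).
  { intros e k Hk.
    apply filterlim_ext with (fun k => ((1 * z (x0 + k) t0 + M * kink_branch A l xi e (x0 + k)) -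
       (1 * z x0 t0 + M * kink_branch A l xi e x0)) / k).
    { intros v; rewrite !Rmult_1_l; reflexivity. }
    rewrite <- (Rmult_1_l k).
    apply (sided_deriv_lin (at_left 0) (fun y => z y t0) (kink_branch A l xi e)); [exact Hk|].
    apply is_derive_lderiv, kink_branch_is_derive, Hl. }
  destruct (Req_dec x0 0) as [E0|N0]; [|destruct (Req_dec x0 l) as [E1|N1];
    [|destruct (Req_dec x0 xi) as [E2|N2]]].
  - destruct (Hb0 t0 Ht0') as (k & Hk & Hk2). rewrite E0 in *.
    assert (Hp : 0 <= k + M * ((A * (2 * 0 / l - 1) + 1) * kink_branch A l xi 1 0)).
    { apply (rderiv_min (fun y => z y t0 + M * kink_branch A l xi 1 y) 0 _ (Rmin l xi)).
      - apply Rmin_glb_lt; assumption.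
      - apply Hsr, Hk.
      - intros y Hy. pose proof (Rmin_l l xi). pose proof (Rmin_r l xi).
        rewrite Hbr0 by (apply kink_weight_left; lra).
        apply Hbr; [lra|apply kink_weight_left; lra]. }
    assert (Hgg : kink_branch A l xi 1 0 = g 0) by (symmetry; apply kink_weight_left; lra).
    rewrite Hgg in Hp. replace (2 * 0 / l) with 0 in Hp by (field; lra).
    assert (Hk3 : k <= b0 / d * z 0 t0).
    { apply Rmult_le_reg_l with d; [exact Hd|].
      replace (d * (b0 / d * z 0 t0)) with (b0 * z 0 t0) by (field; lra). exact Hk2. }
    rewrite HZ0 in Hk3. pose proof (Rle_abs (- (b0 / d))) as Hab. rewrite Rabs_Ropp in Hab.
    assert (0 < M * g 0) by (apply Rmult_lt_0_compat; [exact HM|apply Hg]).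
    nra.
  - destruct (Hb1 t0 Ht0') as (k & Hk & Hk2). rewrite E1 in *.
    assert (He : exists e, -1 <= e /\ g l = kink_branch A l xi e l /\
       k + M * ((A * (2 * l / l - 1) + e) * kink_branch A l xi e l) <= 0).
    { destruct (Rlt_dec xi l) as [Hlt|Hge].
      - exists (-1). split; [lra|]. split; [apply kink_weight_right; lra|].
        apply (lderiv_min (fun y => z y t0 + M * kink_branch A l xi (-1) y) l _ (l - xi)); [lra| |].
        + apply Hsl, Hk.
        + intros y Hy. rewrite Hbr0 by (apply kink_weight_right; lra).
          apply Hbr; [lra|apply kink_weight_right; lra].
      - exists 1. split; [lra|]. split; [apply kink_weight_left; lra|].
        apply (lderiv_min (fun y => z y t0 + M * kink_branch A l xi 1 y) l _ l); [lra| |].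
        + apply Hsl, Hk.
        + intros y Hy. rewrite Hbr0 by (apply kink_weight_left; lra).
          apply Hbr; [lra|apply kink_weight_left; lra]. }
    destruct He as (e & He1 & Hgg & Hp).
    rewrite <- Hgg in Hp. replace (2 * l / l) with 2 in Hp by (field; lra).
    assert (Hk3 : b1 / d * z l t0 <= k).
    { apply Rmult_le_reg_l with d; [exact Hd|].
      replace (d * (b1 / d * z l t0)) with (b1 * z l t0) by (field; lra). exact Hk2. }
    rewrite HZ0 in Hk3. pose proof (Rle_abs (b1 / d)) as Hab.
    assert (0 < M * g l) by (apply Rmult_lt_0_compat; [exact HM|apply Hg]).
    nra.
  - rewrite E2 in *. assert (Hin : 0 < xi < l) by lra.
    destruct (Hix t0 Ht0' Hin) as [k Hk].
    assert (Hp : 0 <= k + M * ((A * (2 * xi / l - 1) + -1) * kink_branch A l xi (-1) xi)).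
    { apply (rderiv_min (fun y => z y t0 + M * kink_branch A l xi (-1) y) xi _ (l - xi)); [lra| |].
      - apply Hsr, is_derive_rderiv, Hk.
      - intros y Hy. rewrite Hbr0 by (apply kink_weight_right; lra).
        apply Hbr; [lra|apply kink_weight_right; lra]. }
    assert (Hq : k + M * ((A * (2 * xi / l - 1) + 1) * kink_branch A l xi 1 xi) <= 0).
    { apply (lderiv_min (fun y => z y t0 + M * kink_branch A l xi 1 y) xi _ xi); [lra| |].
      - apply Hsl, is_derive_lderiv, Hk.
      - intros y Hy. rewrite Hbr0 by (apply kink_weight_left; lra).
        apply Hbr; [lra|apply kink_weight_left; lra]. }
    rewrite <- kink_weight_left in Hq by lra. rewrite <- kink_weight_right in Hp by lra.
    fold g in Hp, Hq.
    assert (0 < M * g xi) by (apply Rmult_lt_0_compat; [exact HM|apply Hg]). nra.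
  - assert (Hin : 0 < x0 < l) by lra.
    destruct (Hpde t0 x0 Ht0' Hin N2) as (zx & zxx & zt & HD & Hdt & Hle).
    specialize (Hle Hz0).
    assert (He : exists e del, 0 < del /\ -1 <= e <= 1 /\ forall y, x0 - del < y < x0 + del ->
        0 <= y <= l /\ kink_weight A l xi y = kink_branch A l xi e y).
    { destruct (Rlt_dec x0 xi) as [Hlt|Hge].
      - exists 1, (Rmin (xi - x0) (Rmin x0 (l - x0))).
        split; [repeat apply Rmin_glb_lt; lra|]. split; [lra|]. intros y Hy.
        pose proof (Rmin_l (xi - x0) (Rmin x0 (l - x0))).
        pose proof (Rmin_r (xi - x0) (Rmin x0 (l - x0))).
        pose proof (Rmin_l x0 (l - x0)). pose proof (Rmin_r x0 (l - x0)).
        split; [lra|]. apply kink_weight_left; lra.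
      - exists (-1), (Rmin (x0 - xi) (Rmin x0 (l - x0))).
        split; [repeat apply Rmin_glb_lt; lra|]. split; [lra|]. intros y Hy.
        pose proof (Rmin_l (x0 - xi) (Rmin x0 (l - x0))).
        pose proof (Rmin_r (x0 - xi) (Rmin x0 (l - x0))).
        pose proof (Rmin_l x0 (l - x0)). pose proof (Rmin_r x0 (l - x0)).
        split; [lra|]. apply kink_weight_right; lra. }
    destruct He as (e & del & Hdel & He & Hloc).
    assert (Hx0k : g x0 = kink_branch A l xi e x0) by (apply Hloc; lra).
    destruct (has_d2_min (fun y => 1 * z y t0 + M * kink_branch A l xi e y) x0 _ _ del Hdel
      (has_d2_lin _ _ _ _ _ _ _ 1 M HD (kink_branch_has_d2 A l xi e x0 Hl))) as [E1 E2].
    { intros y Hy. rewrite !Rmult_1_l. destruct (Hloc y Hy) as [Hy1 Hy2].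
      rewrite Hbr0 by (exact Hx0k). apply Hbr; assumption. }
    assert (E3 : zt + M * C * g x0 <= 0).
    { apply (lderiv_min (fun s => 1 * z x0 s + mu * g x0 * exp (C * s)) t0 _ t0); [lra| |].
      - replace (zt + M * C * g x0) with (1 * zt + mu * g x0 * (C * exp (C * t0)))
          by (unfold M; ring).
        apply (sided_deriv_lin (at_left 0) (fun s => z x0 s) (fun s => exp (C * s))).
        + apply is_derive_lderiv, Hdt.
        + apply is_derive_lderiv. auto_derive; [trivial|ring].
      - intros s Hs. rewrite !Rmult_1_l, HZ0. unfold M.
        assert (HZs : 0 <= z x0 s + mu * exp (C * s) * g x0) by (apply HZ; lra). lra. }
    rewrite <- Hx0k in E1, E2.
    set (rho := A * (2 * x0 / l - 1) + e) in *.
    assert (Hrho : - (A + 1) <= rho <= A + 1).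
    { assert (0 <= 2 * x0 / l <= 2).
      { split; [apply Rdiv_le_0_compat; lra|]. apply Rle_div_l; lra. }
      unfold rho. nra. }
    assert (HMg : 0 < M * g x0) by (apply Rmult_lt_0_compat; [exact HM|apply Hg]).
    rewrite HZ0 in Hle.
    assert (Hzx : zx = - (rho * (M * g x0))) by lra.
    assert (Hzxx : - ((2 * A / l + rho ^ 2) * (M * g x0)) <= zxx) by lra.
    assert (Hrho2 : rho ^ 2 <= (A + 1) ^ 2) by nra.
    assert (Ha : - (a * rho) <= Rabs a * (A + 1)).
    { apply Rle_trans with (Rabs (a * rho)).
      - rewrite <- Rabs_Ropp. apply Rle_abs.
      - rewrite Rabs_mult. apply Rmult_le_compat_l; [apply Rabs_pos|]. apply Rabs_le; lra. }
    assert (Hfin : d * (2 * A / l + rho ^ 2) - a * rho + K < C) by (unfold C; nra).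
    assert (Hz1 : - (d * ((2 * A / l + rho ^ 2) * (M * g x0))) <= d * zxx) by nra.
    subst zx. nra.
Qed.

(** * Zero-flux elliptic comparison *)

Lemma exp_scal_is_derive (c x : R) : is_derive (fun y => exp (c * y)) x (c * exp (c * x)).
Proof. auto_derive; [trivial|ring]. Qed.

Lemma exp_nondecreasing (x y : R) : x <= y -> exp x <= exp y.
Proof. intros [H| ->]; [left; apply exp_increasing, H|right; reflexivity]. Qed.

Lemma exp_scal_has_d2 (c x : R) :
  has_d2 (fun y => exp (c * y)) x (c * exp (c * x)) (c ^ 2 * exp (c * x)).
Proof.
  apply (has_d2_global _ (fun y => c * exp (c * y))).
  - intros; apply exp_scal_is_derive.
  - auto_derive; [trivial|ring].
Qed.

Lemma exp_decay (B q e : R) : 0 < q -> 0 < e -> exists T, forall t, T < t -> B * exp (- q * t) < e.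
Proof.
  intros Hq He. exists (Rmax 0 (B / (q * e))). intros t Ht.
  assert (0 < t) by (eapply Rle_lt_trans; [apply Rmax_l|exact Ht]).
  assert (H1 : B / (q * e) < t) by (eapply Rle_lt_trans; [apply Rmax_r|exact Ht]).
  apply Rlt_div_l in H1; [|nra].
  replace (- q * t) with (- (q * t)) by ring. rewrite exp_Ropp.
  assert (H2 : 1 + q * t < exp (q * t)) by (apply exp_ineq1; nra).
  apply (Rmult_lt_reg_r (exp (q * t))); [apply exp_pos|].
  rewrite Rmult_assoc, Rinv_l by (pose proof (exp_pos (q * t)); lra). nra.
Qed.

Lemma strip_lin (f W : R -> R -> R) (e : R -> R) (p a b : R) :
  cont_on_strip f a b -> (forall t, continuous e t) -> cont_on_strip W a b ->
  cont_on_strip (fun x t => p * f x t + e t * W x t) a b.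
Proof.
  intros Hf He HW x t Hx Ht.
  apply (filterlim_comp_2 (G := locally (p * f x t)) (H := locally (e t * W x t))).
  - eapply filterlim_comp; [apply (Hf x t Hx Ht)|]. apply (filterlim_scal_r p (f x t)).
  - apply (filterlim_comp_2 (G := locally (e t)) (H := locally (W x t))).
    + eapply filterlim_filter_le_1; [apply filter_le_within|].
      apply (continuous_comp (U := prod_UniformSpace R_UniformSpace R_UniformSpace) snd e (x, t));
        [apply continuous_snd|apply He].
    + apply (HW x t Hx Ht).
    + apply (filterlim_mult (e t) (W x t)).
  - apply (filterlim_plus (p * f x t) (e t * W x t)).
Qed.

Lemma strip_steady (v : R -> R) (a b : R) :
  cont_on v a b -> cont_on_strip (fun x _ => v x) a b.
Proof.
  intros H x t Hx Ht P HP. destruct (H x Hx P HP) as [del Hdel].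
  exists del. intros [y s] [H1 _] [H2 _]. apply Hdel; assumption.
Qed.

Lemma continuous_cont_on (v : R -> R) (a b : R) :
  (forall x, continuous v x) -> cont_on v a b.
Proof.
  intros H x Hx. eapply filterlim_filter_le_1; [apply filter_le_within|]. apply H.
Qed.

Lemma exp_scal_continuous (c x : R) : continuous (fun y => exp (c * y)) x.
Proof. eapply is_derive_cont, exp_scal_is_derive. Qed.

Lemma exp_time_continuous (C c t : R) : continuous (fun s => C * exp (c * s)) t.
Proof. eapply is_derive_cont. auto_derive; trivial. Qed.

Lemma cont_on_lower_bound (v : R -> R) (a b : R) :
  a <= b -> cont_on v a b -> exists B, 0 < B /\ forall x, a <= x <= b -> - B <= v x.
Proof.
  intros Hab H. destruct (strip_bound (fun x _ => v x) a b 0 Hab (Rle_refl 0) (strip_steady v a b H))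
    as (B & HB & Hb).
  exists B. split; [exact HB|]. intros x Hx. apply (Hb x 0 Hx). lra.
Qed.

(* [v] is a steady state of the parabolic problem, and the zero-flux solution
   [e^(-qt) e^(ax/d)] brings any initial deficit back to [0]. *)
Lemma elliptic_min (d a q l : R) (v : R -> R) :
  0 < d -> 0 <= a -> 0 < q -> 0 < l -> cont_on v 0 l ->
  (forall x, 0 < x < l -> exists v1 v2, has_d2 v x v1 v2 /\ d * v2 - a * v1 - q * v x <= 0) ->
  (exists k, rderiv v 0 k /\ d * k <= a * v 0) ->
  (exists k, lderiv v l k /\ a * v l <= d * k) ->
  forall x, 0 <= x <= l -> 0 <= v x.
Proof.
  intros Hd Ha Hq Hl Hc Hode (k0 & Hk0 & Hk0') (k1 & Hk1 & Hk1') x Hx.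
  destruct (cont_on_lower_bound v 0 l (Rlt_le _ _ Hl) Hc) as (B & HB & Hvb).
  assert (Had : 0 <= a / d) by (apply Rdiv_le_0_compat; lra).
  assert (HE1 : forall y, 0 <= y -> 1 <= exp (a / d * y)).
  { intros y Hy. pose proof (exp_ineq1_le (a / d * y)). nra. }
  pose (z := fun x t => 1 * v x + B * exp (- q * t) * exp (a / d * x)).
  assert (Hz : forall t, 0 <= t -> 0 <= z x t).
  { intros t Ht. apply (parabolic_min l t d a 0 a a l z Hl Hd Hl); [| | | | | |exact Hx|lra].
    - apply (strip_lin (fun x _ => v x) (fun x _ => exp (a / d * x)) (fun t => B * exp (- q * t))).
      + apply strip_steady, Hc.
      + intros s; apply exp_time_continuous.
      + apply strip_steady, continuous_cont_on. intros; apply exp_scal_continuous.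
    - intros y Hy. unfold z. rewrite Rmult_0_r, exp_0. specialize (Hvb y Hy).
      specialize (HE1 y (proj1 Hy)). nra.
    - intros s Hs Hb; lra.
    - intros s y Hs Hy _. destruct (Hode y Hy) as (v1 & v2 & Hv & Hle).
      exists (1 * v1 + B * exp (- q * s) * (a / d * exp (a / d * y))),
        (1 * v2 + B * exp (- q * s) * ((a / d) ^ 2 * exp (a / d * y))),
        (- q * (B * exp (- q * s) * exp (a / d * y))).
      split; [apply has_d2_lin; [exact Hv|apply exp_scal_has_d2]|].
      split; [unfold z; auto_derive; [trivial|ring]|].
      unfold z. intros Hneg.
      replace (d * (1 * v2 + B * exp (- q * s) * ((a / d) ^ 2 * exp (a / d * y))) -
       a * (1 * v1 + B * exp (- q * s) * (a / d * exp (a / d * y))))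
      with (d * v2 - a * v1) by (field; lra).
      set (w := B * exp (- q * s) * exp (a / d * y)) in *. nra.
    - intros s Hs. exists (1 * k0 + B * exp (- q * s) * (a / d * exp (a / d * 0))). split.
      + apply (sided_deriv_lin (at_right 0) v (fun y => exp (a / d * y))); [exact Hk0|].
        apply is_derive_rderiv, exp_scal_is_derive.
      + unfold z. set (w := B * exp (- q * s)). set (w' := exp (a / d * 0)).
        replace (d * (1 * k0 + w * (a / d * w'))) with (d * k0 + a * (w * w')) by (field; lra). lra.
    - intros s Hs. exists (1 * k1 + B * exp (- q * s) * (a / d * exp (a / d * l))). split.
      + apply (sided_deriv_lin (at_left 0) v (fun y => exp (a / d * y))); [exact Hk1|].
        apply is_derive_lderiv, exp_scal_is_derive.
      + unfold z. set (w := B * exp (- q * s)). set (w' := exp (a / d * l)).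
        replace (d * (1 * k1 + w * (a / d * w'))) with (d * k1 + a * (w * w')) by (field; lra). lra. }
  destruct (Rle_dec 0 (v x)) as [|Hn]; [assumption|exfalso].
  destruct (exp_decay (B * exp (a / d * x)) q (- v x) Hq) as [T HT]; [lra|].
  pose proof (Rmax_l T 0). pose proof (Rmax_r T 0).
  specialize (HT (Rmax T 0 + 1) ltac:(lra)). specialize (Hz (Rmax T 0 + 1) ltac:(lra)).
  unfold z in Hz. lra.
Qed.

Lemma flux_lin_right (d a x p q : R) (f g : R -> R) :
  (exists k, rderiv f x k /\ d * k - a * f x = 0) ->
  (exists k, rderiv g x k /\ d * k - a * g x = 0) ->
  exists k, rderiv (fun y => p * f y + q * g y) x k /\ d * k - a * (p * f x + q * g x) = 0.
Proof.
  intros (k1 & H1 & E1) (k2 & H2 & E2). exists (p * k1 + q * k2). split.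
  - apply (sided_deriv_lin (at_right 0) f g); assumption.
  - replace (d * (p * k1 + q * k2) - a * (p * f x + q * g x))
      with (p * (d * k1 - a * f x) + q * (d * k2 - a * g x)) by ring. rewrite E1, E2; ring.
Qed.

Lemma flux_lin_left (d a x p q : R) (f g : R -> R) :
  (exists k, lderiv f x k /\ d * k - a * f x = 0) ->
  (exists k, lderiv g x k /\ d * k - a * g x = 0) ->
  exists k, lderiv (fun y => p * f y + q * g y) x k /\ d * k - a * (p * f x + q * g x) = 0.
Proof.
  intros (k1 & H1 & E1) (k2 & H2 & E2). exists (p * k1 + q * k2). split.
  - apply (sided_deriv_lin (at_left 0) f g); assumption.
  - replace (d * (p * k1 + q * k2) - a * (p * f x + q * g x))
      with (p * (d * k1 - a * f x) + q * (d * k2 - a * g x)) by ring. rewrite E1, E2; ring.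
Qed.

Lemma exp_flux_right (d a x : R) : 0 < d ->
  exists k, rderiv (fun y => exp (a / d * y)) x k /\ d * k - a * exp (a / d * x) = 0.
Proof.
  intros Hd. exists (a / d * exp (a / d * x)).
  split; [apply is_derive_rderiv, exp_scal_is_derive|]. field; lra.
Qed.

Lemma exp_flux_left (d a x : R) : 0 < d ->
  exists k, lderiv (fun y => exp (a / d * y)) x k /\ d * k - a * exp (a / d * x) = 0.
Proof.
  intros Hd. exists (a / d * exp (a / d * x)).
  split; [apply is_derive_lderiv, exp_scal_is_derive|]. field; lra.
Qed.

Lemma cont_on_lin (f g : R -> R) (p q a b : R) :
  cont_on f a b -> cont_on g a b -> cont_on (fun y => p * f y + q * g y) a b.
Proof.
  intros Hf Hg x Hx.
  apply (filterlim_comp_2 (G := locally (p * f x)) (H := locally (q * g x))).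
  - eapply filterlim_comp; [apply (Hf x Hx)|]. apply (filterlim_scal_r p (f x)).
  - eapply filterlim_comp; [apply (Hg x Hx)|]. apply (filterlim_scal_r q (g x)).
  - apply (filterlim_plus (p * f x) (q * g x)).
Qed.

Lemma wbar_has_d2 (d a h q l : R) (wb : R -> R) : is_wbar d a h q l wb ->
  forall x, 0 < x < l -> has_d2 wb x (Derive wb x) (D2 wb x) /\
    d * D2 wb x - a * Derive wb x + h - q * wb x = 0.
Proof.
  intros (_ & _ & H & _) x Hx. split; [|apply H, Hx].
  apply has_d2_Derive with 0 l; [exact Hx| |apply H, Hx]. intros y Hy; apply H, Hy.
Qed.

Section WbarBounds.
Variables (d a h q l : R) (wb : R -> R).
Hypotheses (Hd : 0 < d) (Ha : 0 <= a) (Hh : 0 < h) (Hq : 0 < q) (Hl : 0 < l)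
  (Hwb : is_wbar d a h q l wb).

Lemma elliptic_min_flux (v : R -> R) : cont_on v 0 l ->
  (forall x, 0 < x < l -> exists v1 v2, has_d2 v x v1 v2 /\ d * v2 - a * v1 - q * v x <= 0) ->
  (exists k, rderiv v 0 k /\ d * k - a * v 0 = 0) ->
  (exists k, lderiv v l k /\ d * k - a * v l = 0) ->
  forall x, 0 <= x <= l -> 0 <= v x.
Proof.
  intros Hc Ho (k0 & Hk0 & E0) (k1 & Hk1 & E1).
  apply (elliptic_min d a q l v Hd Ha Hq Hl Hc Ho).
  - exists k0; split; [exact Hk0|lra].
  - exists k1; split; [exact Hk1|lra].
Qed.

Lemma wbar_compare (q' c : R) (wb' : R -> R) :
  is_wbar d a h q' l wb' ->
  (forall x, 0 < x < l -> (c - 1) * h <= c * ((q' - q) * wb' x)) ->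
  forall x, 0 <= x <= l -> c * wb' x <= wb x.
Proof.
  intros Hwb' Hle x Hx.
  assert (0 <= 1 * wb x + (- c) * wb' x); [|lra].
  apply (elliptic_min_flux (fun x => 1 * wb x + (- c) * wb' x)); [| | | |exact Hx].
  - apply cont_on_lin; [apply Hwb|apply Hwb'].
  - intros y Hy. destruct (wbar_has_d2 _ _ _ _ _ _ Hwb y Hy) as [A1 A2].
    destruct (wbar_has_d2 _ _ _ _ _ _ Hwb' y Hy) as [B1 B2].
    eexists _, _. split; [apply has_d2_lin; eassumption|].
    specialize (Hle y Hy).
    assert (E1 : d * D2 wb y = a * Derive wb y - h + q * wb y) by lra.
    assert (E2 : d * D2 wb' y = a * Derive wb' y - h + q' * wb' y) by lra.
    nra.
  - apply flux_lin_right; [apply Hwb|apply Hwb'].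
  - apply flux_lin_left; [apply Hwb|apply Hwb'].
Qed.

Lemma exp_flux_ode (x : R) :
  d * ((a / d) ^ 2 * exp (a / d * x)) - a * (a / d * exp (a / d * x)) = 0.
Proof. field; lra. Qed.

Lemma wbar_lower x : 0 <= x <= l -> h / q * exp (- (a / d * l)) <= wb x.
Proof.
  intros Hx. set (k := h / q * exp (- (a / d * l))).
  assert (Hk : 0 < k) by (apply Rmult_lt_0_compat; [apply Rdiv_lt_0_compat; lra|apply exp_pos]).
  assert (Had : 0 <= a / d) by (apply Rdiv_le_0_compat; lra).
  assert (0 <= 1 * wb x + (- k) * exp (a / d * x)).
  { apply (elliptic_min_flux (fun x => 1 * wb x + (- k) * exp (a / d * x))); [| | | |exact Hx].
    - apply cont_on_lin; [apply Hwb|]. apply continuous_cont_on; intros; apply exp_scal_continuous.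
    - intros y Hy. destruct (wbar_has_d2 _ _ _ _ _ _ Hwb y Hy) as [A1 A2].
      eexists _, _. split; [apply has_d2_lin; [eassumption|apply exp_scal_has_d2]|].
      pose proof (exp_flux_ode y) as E.
      assert (E1 : q * (k * exp (a / d * y)) <= h).
      { unfold k. replace (q * (h / q * exp (- (a / d * l)) * exp (a / d * y)))
          with (h * (exp (- (a / d * l)) * exp (a / d * y))) by (field; lra).
        rewrite <- exp_plus. rewrite <- (Rmult_1_r h) at 2. apply Rmult_le_compat_l; [lra|].
        rewrite <- exp_0. apply exp_nondecreasing. nra. }
      nra.
    - apply (flux_lin_right d a 0 1 (- k) wb (fun y => exp (a / d * y)));
        [apply Hwb|apply exp_flux_right, Hd].
    - apply (flux_lin_left d a l 1 (- k) wb (fun y => exp (a / d * y)));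
        [apply Hwb|apply exp_flux_left, Hd]. }
  assert (1 <= exp (a / d * x)).
  { pose proof (exp_ineq1_le (a / d * x)). nra. }
  nra.
Qed.

Lemma wbar_upper x : 0 <= x <= l -> wb x <= h / q * exp (a / d * l).
Proof.
  intros Hx. set (k := h / q).
  assert (Hk : 0 < k) by (apply Rdiv_lt_0_compat; lra).
  assert (Had : 0 <= a / d) by (apply Rdiv_le_0_compat; lra).
  assert (0 <= (-1) * wb x + k * exp (a / d * x)).
  { apply (elliptic_min_flux (fun x => (-1) * wb x + k * exp (a / d * x))); [| | | |exact Hx].
    - apply cont_on_lin; [apply Hwb|]. apply continuous_cont_on; intros; apply exp_scal_continuous.
    - intros y Hy. destruct (wbar_has_d2 _ _ _ _ _ _ Hwb y Hy) as [A1 A2].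
      eexists _, _. split; [apply has_d2_lin; [eassumption|apply exp_scal_has_d2]|].
      pose proof (exp_flux_ode y) as E.
      assert (E1 : h <= q * (k * exp (a / d * y))).
      { unfold k. replace (q * (h / q * exp (a / d * y))) with (h * exp (a / d * y)) by (field; lra).
        pose proof (exp_ineq1_le (a / d * y)).
        assert (0 <= a / d * y) by (apply Rmult_le_pos; lra). nra. }
      nra.
    - apply (flux_lin_right d a 0 (-1) k wb (fun y => exp (a / d * y)));
        [apply Hwb|apply exp_flux_right, Hd].
    - apply (flux_lin_left d a l (-1) k wb (fun y => exp (a / d * y)));
        [apply Hwb|apply exp_flux_left, Hd]. }
  assert (exp (a / d * x) <= exp (a / d * l)).
  { apply exp_nondecreasing. nra. }
  nra.
Qed.
End WbarBounds.

(** * Shooting *)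

Lemma RInt_is_derive (f : R -> R) (x : R) :
  (forall y, continuous f y) -> is_derive (fun y => RInt f 0 y) x (f x).
Proof.
  intros H. apply (is_derive_RInt f (fun y => RInt f 0 y) 0 x); [|apply H].
  apply filter_forall. intros y. apply (RInt_correct f 0 y).
  apply (ex_RInt_continuous (V := R_CompleteNormedModule)). intros; apply H.
Qed.

Lemma ex_RInt_of_continuous (f : R -> R) (a b : R) : (forall y, continuous f y) -> ex_RInt f a b.
Proof. intros H. apply (ex_RInt_continuous (V := R_CompleteNormedModule)). intros; apply H. Qed.

Lemma continuous_Rmin_l (a x : R) : continuous (fun y => Rmin y a) x.
Proof.
  apply continuous_ext with (fun y => (y + a - Rabs (y - a)) / 2).
  { intros y. unfold Rmin. destruct (Rle_dec y a); [rewrite Rabs_left1|rewrite Rabs_pos_eq]; lra. }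
  apply (continuous_mult (fun y => y + a - Rabs (y - a)) (fun _ => / 2)); [|apply continuous_const].
  apply (continuous_minus (fun y => y + a) (fun y => Rabs (y - a))).
  - eapply is_derive_cont; auto_derive; trivial.
  - apply (continuous_comp (fun y => y - a) Rabs); [|apply continuous_Rabs].
    eapply is_derive_cont; auto_derive; trivial.
Qed.

Definition clamp (L x : R) : R := Rmin (Rmax x 0) L.

Lemma clamp_continuous (L x : R) : continuous (clamp L) x.
Proof.
  apply (continuous_comp (fun y => Rmax y 0) (fun y => Rmin y L)); [|apply continuous_Rmin_l].
  apply continuous_ext with (fun y => - Rmin (- y) 0).
  { intros y. unfold Rmin, Rmax. destruct (Rle_dec (- y) 0), (Rle_dec y 0); lra. }
  apply (continuous_opp (fun y => Rmin (- y) 0)).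
  apply (continuous_comp (fun y => - y) (fun y => Rmin y 0)); [|apply continuous_Rmin_l].
  eapply (is_derive_cont (fun y => - y)); auto_derive; trivial.
Qed.

Lemma clamp_id (L x : R) : 0 <= x <= L -> clamp L x = x.
Proof. intros H. unfold clamp. rewrite Rmax_left by lra. apply Rmin_left; lra. Qed.

Lemma clamp_range (L x : R) : 0 <= L -> 0 <= clamp L x <= L.
Proof.
  intros H. unfold clamp. split; [|apply Rmin_r]. apply Rmin_glb; [apply Rmax_r|exact H].
Qed.

Lemma abs_le_of_deriv (D D1 : R -> R) (L C Q x : R) :
  0 < C -> (forall y, is_derive D y (D1 y)) -> D 0 = 0 -> 0 <= Q ->
  (forall y, 0 <= y <= L -> Rabs (D1 y) <= Q * exp (C * y)) ->
  0 <= x <= L -> Rabs (D x) <= Q / C * exp (C * x).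
Proof.
  intros HC HD H0 HQ Hb Hx.
  assert (HG : forall y, is_derive (fun y => Q / C * exp (C * y)) y (Q * exp (C * y))).
  { intros y. auto_derive; [trivial|]. field; lra. }
  assert (HQC : 0 <= Q / C) by (apply Rdiv_le_0_compat; lra).
  assert (Hs : forall s, s = 1 \/ s = -1 -> 0 <= Q / C * exp (C * x) + s * D x).
  { intros s Hs. apply Rle_trans with (Q / C * exp (C * 0) + s * D 0).
    - rewrite H0, Rmult_0_r, exp_0. lra.
    - assert (Hd : forall y, is_derive (fun y => Q / C * exp (C * y) + s * D y) y
          (Q * exp (C * y) + s * D1 y)).
      { intros y. apply (is_derive_plus (fun y => Q / C * exp (C * y)) (fun y => s * D y)); [apply HG|].
        apply (is_derive_scal D y s), HD. }
      apply (nondecreasing_of_deriv (fun y => Q / C * exp (C * y) + s * D y)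
         (fun y => Q * exp (C * y) + s * D1 y)); [lra| |].
      + intros y _. eapply is_derive_cont, Hd.
      + intros y Hy. split; [apply Hd|]. assert (Hy' : 0 <= y <= L) by lra.
        specialize (Hb y Hy').
        pose proof (Rle_abs (D1 y)). pose proof (Rle_abs (- D1 y)) as Hn. rewrite Rabs_Ropp in Hn.
        destruct Hs as [-> | ->]; lra. }
  pose proof (Hs 1 (or_introl eq_refl)). pose proof (Hs (-1) (or_intror eq_refl)).
  apply Rabs_le; lra.
Qed.

Lemma geometric_limit (u : nat -> R) (K : R) :
  (forall n, Rabs (u (S n) - u n) <= K * (1 / 2) ^ n) ->
  exists l, forall n, Rabs (u n - l) <= 2 * K * (1 / 2) ^ n.
Proof.
  intros H.
  assert (HK : 0 <= K) by (specialize (H O); pose proof (Rabs_pos (u 1%nat - u O)); simpl in H; lra).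
  assert (Hp : forall n, 0 < (1 / 2) ^ n) by (intro n; apply pow_lt; lra).
  assert (Ht : forall n k, Rabs (u (n + k)%nat - u n) <= 2 * K * (1 / 2) ^ n - 2 * K * (1 / 2) ^ (n + k)).
  { intros n. induction k as [|k IH].
    - rewrite Nat.add_0_r. rewrite Rminus_diag, Rabs_R0. lra.
    - rewrite Nat.add_succ_r. simpl.
      replace (u (S (n + k)) - u n) with ((u (S (n + k)) - u (n + k)%nat) + (u (n + k)%nat - u n)) by ring.
      eapply Rle_trans; [apply Rabs_triang|]. specialize (H (n + k)%nat). lra. }
  assert (Hc : Cauchy_crit u).
  { intros e He.
    destruct (pow_lt_1_zero (1 / 2) ltac:(rewrite Rabs_pos_eq; lra) (e / (4 * K + 1))
       ltac:(apply Rdiv_lt_0_compat; lra)) as [N HN].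
    exists N. intros n m Hn Hm.
    assert (Hk : forall j, (j >= N)%nat -> Rabs (u j - u N) <= 2 * K * (1 / 2) ^ N).
    { intros j Hj. replace j with (N + (j - N))%nat by lia. specialize (Ht N (j - N)%nat).
      pose proof (Hp (N + (j - N))%nat). nra. }
    specialize (HN N (le_n N)). rewrite Rabs_pos_eq in HN by (apply Rlt_le, Hp).
    apply Rlt_div_r in HN; [|lra].
    unfold Rdist. replace (u n - u m) with ((u n - u N) + - (u m - u N)) by ring.
    eapply Rle_lt_trans; [apply Rabs_triang|]. rewrite Rabs_Ropp.
    pose proof (Hk n Hn). pose proof (Hk m Hm). pose proof (Hp N). lra. }
  destruct (Rcomplete.R_complete u Hc) as [l Hl]. exists l. intros n.
  apply le_epsilon. intros e He. destruct (Hl e He) as [N HN].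
  specialize (HN (n + N)%nat ltac:(lia)). specialize (Ht n N). unfold Rdist in HN.
  replace (u n - l) with (- (u (n + N)%nat - u n) + (u (n + N)%nat - l)) by ring.
  eapply Rle_trans; [apply Rabs_triang|]. rewrite Rabs_Ropp. pose proof (Hp (n + N)%nat). nra.
Qed.

Lemma zero_of_geometric_bound (y K : R) : (forall n, Rabs y <= K * (1 / 2) ^ n) -> y = 0.
Proof.
  intros H. destruct (Req_dec y 0) as [|Hy]; [assumption|exfalso].
  assert (Hy' : 0 < Rabs y) by (apply Rabs_pos_lt, Hy).
  assert (HK : 0 < K) by (specialize (H O); simpl in H; lra).
  destruct (pow_lt_1_zero (1 / 2) ltac:(rewrite Rabs_pos_eq; lra) (Rabs y / K)
       ltac:(apply Rdiv_lt_0_compat; lra)) as [N HN].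
  specialize (HN N (le_n N)). rewrite Rabs_pos_eq in HN by (apply pow_le; lra).
  apply Rlt_div_r in HN; [|lra]. specialize (H N). lra.
Qed.

Section Shooting.
Variables (b L x2 B : R) (beta : R -> R).
Hypotheses (Hb : 0 < b) (HL : 0 < L) (Hx2 : 0 < x2) (Hcb : forall x, continuous beta x)
  (Hbeta : forall x, 0 <= x <= L -> 0 <= beta x <= B).

(* The problem [phi'' = b phi' + (alpha + chi beta) phi], [phi 0 = 1], [phi' 0 = b], written with the
   flux [phi' - b phi] as a fixed-point equation; [clamp] makes the operator see [phi] on [0,L] only. *)
Definition flux (alpha : R) (f : R -> R) (t : R) : R :=
  alpha * RInt (fun s => f (clamp L s)) 0 t + RInt (fun s => beta s * f (clamp L s)) 0 (Rmin t x2).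
Definition slope (alpha : R) (f : R -> R) (t : R) : R := b * f (clamp L t) + flux alpha f t.
Definition picard (alpha : R) (f : R -> R) (x : R) : R := 1 + RInt (slope alpha f) 0 x.

Section Operator.
Variables (alpha : R) (f : R -> R).
Hypothesis (Hf : forall x, continuous f x).

Lemma comp_clamp_continuous x : continuous (fun s => f (clamp L s)) x.
Proof. apply (continuous_comp (clamp L) f); [apply clamp_continuous|apply Hf]. Qed.

Lemma beta_comp_continuous x : continuous (fun s => beta s * f (clamp L s)) x.
Proof. apply (continuous_mult beta); [apply Hcb|apply comp_clamp_continuous]. Qed.

Lemma slope_continuous x : continuous (slope alpha f) x.
Proof.
  unfold slope, flux.
  apply (continuous_plus (fun t => b * f (clamp L t))).
  - apply (continuous_mult (fun _ => b) (fun t => f (clamp L t))); [apply continuous_const|].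
    apply comp_clamp_continuous.
  - apply (continuous_plus (fun t => alpha * RInt (fun s => f (clamp L s)) 0 t)).
    + apply (continuous_mult (fun _ => alpha)); [apply continuous_const|].
      eapply is_derive_cont, RInt_is_derive, comp_clamp_continuous.
    + apply (continuous_comp (fun t => Rmin t x2) (fun t => RInt (fun s => beta s * f (clamp L s)) 0 t));
        [apply continuous_Rmin_l|].
      eapply is_derive_cont, RInt_is_derive, beta_comp_continuous.
Qed.

Lemma picard_is_derive x : is_derive (picard alpha f) x (slope alpha f x).
Proof.
  unfold picard. eapply is_derive_eq.
  - apply (is_derive_plus (fun _ => 1) (fun x => RInt (slope alpha f) 0 x)).
    + apply (is_derive_const 1).
    + apply RInt_is_derive, slope_continuous.
  - apply Rplus_0_l.
Qed.

Lemma picard_continuous x : continuous (picard alpha f) x.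
Proof. eapply is_derive_cont, picard_is_derive. Qed.

Lemma slope_bound (M C : R) :
  0 <= C -> 0 <= M -> (forall s, 0 <= s <= L -> Rabs (f s) <= M * exp (C * s)) ->
  forall t, 0 <= t <= L -> Rabs (slope alpha f t) <= (b + (Rabs alpha + B) * L) * M * exp (C * t).
Proof.
  intros HC HM Hs t Ht.
  assert (Hle : forall s, 0 <= s <= t -> Rabs (f (clamp L s)) <= M * exp (C * t)).
  { intros s Hst. rewrite clamp_id by lra. eapply Rle_trans; [apply Hs; lra|].
    apply Rmult_le_compat_l; [exact HM|]. apply exp_nondecreasing. nra. }
  pose proof (exp_pos (C * t)) as Hep. set (E := exp (C * t)) in *.
  assert (HME : 0 <= M * E) by nra.
  assert (HB : 0 <= B) by (pose proof (Hbeta 0 ltac:(lra)); lra).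
  assert (H1 : Rabs (RInt (fun s => f (clamp L s)) 0 t) <= L * (M * E)).
  { eapply Rle_trans; [apply abs_RInt_le_const with (M := M * E); [lra| |exact Hle]|].
    - apply ex_RInt_of_continuous, comp_clamp_continuous.
    - nra. }
  assert (H2 : Rabs (RInt (fun s => beta s * f (clamp L s)) 0 (Rmin t x2)) <= L * (B * (M * E))).
  { assert (Hm0 : 0 <= Rmin t x2) by (apply Rmin_glb; lra).
    assert (Hm1 : Rmin t x2 <= t) by apply Rmin_l.
    eapply Rle_trans; [apply abs_RInt_le_const with (M := B * (M * E)); [lra| |]|].
    - apply ex_RInt_of_continuous, beta_comp_continuous.
    - intros s Hst. rewrite Rabs_mult.
      assert (Hsr : 0 <= s <= L) by lra. pose proof (Hbeta s Hsr).
      apply Rmult_le_compat; try apply Rabs_pos; [rewrite Rabs_pos_eq; lra|apply Hle; lra].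
    - assert (0 <= B * (M * E)) by nra. nra. }
  unfold slope, flux.
  eapply Rle_trans; [apply Rabs_triang|].
  eapply Rle_trans; [apply Rplus_le_compat_l, Rabs_triang|].
  rewrite !Rabs_mult, (Rabs_pos_eq b) by lra.
  pose proof (Hle t ltac:(lra)) as H3.
  pose proof (Rabs_pos alpha) as Ha.
  assert (b * Rabs (f (clamp L t)) <= b * (M * E)) by nra.
  assert (Rabs alpha * Rabs (RInt (fun s => f (clamp L s)) 0 t) <= Rabs alpha * (L * (M * E)))
    by (apply Rmult_le_compat_l; assumption).
  lra.
Qed.

Lemma slope_nonneg : 0 <= alpha -> (forall s, 0 <= s <= L -> 0 <= f s) ->
  forall t, 0 <= t <= L -> b * f t <= slope alpha f t.
Proof.
  intros Ha Hs t Ht. unfold slope, flux.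
  assert (Hc : forall s, 0 <= f (clamp L s)) by (intro; apply Hs, clamp_range; lra).
  assert (0 <= RInt (fun s => f (clamp L s)) 0 t).
  { apply RInt_ge_0; [lra|apply ex_RInt_of_continuous, comp_clamp_continuous|]. intros; apply Hc. }
  assert (0 <= RInt (fun s => beta s * f (clamp L s)) 0 (Rmin t x2)).
  { assert (Rmin t x2 <= t) by apply Rmin_l.
    apply RInt_ge_0; [apply Rmin_glb; lra|apply ex_RInt_of_continuous, beta_comp_continuous|].
    intros s Hst. apply Rmult_le_pos; [apply Hbeta; lra|apply Hc]. }
  rewrite (clamp_id L t Ht). nra.
Qed.

Lemma picard_ge_1 : 0 <= alpha -> (forall s, 0 <= s <= L -> 0 <= f s) ->
  forall t, 0 <= t <= L -> 1 <= picard alpha f t.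
Proof.
  intros Ha Hs t Ht.
  assert (H0 : picard alpha f 0 = 1) by (unfold picard; rewrite RInt_point; apply Rplus_0_r).
  rewrite <- H0. apply nondecreasing_of_deriv with (slope alpha f); [lra| |].
  - intros; apply picard_continuous.
  - intros x Hx. split; [apply picard_is_derive|].
    apply Rle_trans with (b * f x); [|apply slope_nonneg; auto; lra].
    apply Rmult_le_pos; [lra|apply Hs; lra].
Qed.

Lemma slope_0 : slope alpha f 0 = b * f 0.
Proof.
  unfold slope, flux. rewrite clamp_id by lra. rewrite Rmin_left by lra.
  rewrite !RInt_point. unfold zero; simpl. ring.
Qed.

Lemma slope_is_derive (f1 x : R) : is_derive f x f1 -> 0 < x < L -> x <> x2 ->
  is_derive (slope alpha f) x (b * f1 + (alpha + if Rlt_dec x x2 then beta x else 0) * f x).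
Proof.
  intros Hd Hx Hxx. unfold slope, flux.
  assert (Hloc : locally x (fun y => clamp L y = y)).
  { assert (He : 0 < Rmin x (L - x)) by (apply Rmin_glb_lt; lra).
    exists (mkposreal _ He). intros y Hy. apply Rabs_def2 in Hy.
    unfold minus, plus, opp in Hy; simpl in Hy.
    pose proof (Rmin_l x (L - x)). pose proof (Rmin_r x (L - x)). apply clamp_id; lra. }
  eapply is_derive_eq.
  - apply (is_derive_plus (fun t => b * f (clamp L t))).
    + apply (is_derive_scal (fun t => f (clamp L t)) x b f1).
      apply is_derive_ext_loc with f; [|exact Hd].
      apply filter_imp with (2 := Hloc). intros y Hy; rewrite Hy; reflexivity.
    + apply (is_derive_plus (fun t => alpha * RInt (fun s => f (clamp L s)) 0 t)).
      * apply (is_derive_scal (fun t => RInt (fun s => f (clamp L s)) 0 t) x alpha (f (clamp L x))).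
        apply (RInt_is_derive (fun s => f (clamp L s))), comp_clamp_continuous.
      * instantiate (1 := (if Rlt_dec x x2 then beta x else 0) * f x).
        destruct (Rlt_dec x x2) as [Hlt|Hge].
        -- apply is_derive_ext_loc with (fun t => RInt (fun s => beta s * f (clamp L s)) 0 t).
           { assert (He : 0 < x2 - x) by lra. exists (mkposreal _ He). intros y Hy.
             apply Rabs_def2 in Hy. unfold minus, plus, opp in Hy; simpl in Hy.
             rewrite Rmin_left by lra. reflexivity. }
           pose proof (RInt_is_derive (fun s => beta s * f (clamp L s)) x beta_comp_continuous) as H.
           simpl in H. rewrite (clamp_id L x) in H by lra. exact H.
        -- apply is_derive_ext_loc with (fun t => RInt (fun s => beta s * f (clamp L s)) 0 x2).
           { assert (He : 0 < x - x2) by lra. exists (mkposreal _ He). intros y Hy.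
             apply Rabs_def2 in Hy. unfold minus, plus, opp in Hy; simpl in Hy.
             rewrite Rmin_right by lra. reflexivity. }
           rewrite Rmult_0_l. apply (is_derive_const (RInt (fun s => beta s * f (clamp L s)) 0 x2)).
  - rewrite clamp_id by lra. unfold plus; simpl. ring.
Qed.
End Operator.

Lemma slope_minus (al : R) (f g : R -> R) (t : R) :
  (forall x, continuous f x) -> (forall x, continuous g x) ->
  slope al (fun x => f x - g x) t = slope al f t - slope al g t.
Proof.
  intros Hf Hg. unfold slope, flux.
  pose proof (RInt_minus (fun s => f (clamp L s)) (fun s => g (clamp L s)) 0 t
    (ex_RInt_of_continuous _ _ _ (comp_clamp_continuous f Hf))
    (ex_RInt_of_continuous _ _ _ (comp_clamp_continuous g Hg))) as E1.
  pose proof (RInt_minus (fun s => beta s * f (clamp L s)) (fun s => beta s * g (clamp L s)) 0 (Rmin t x2)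
    (ex_RInt_of_continuous _ _ _ (beta_comp_continuous f Hf))
    (ex_RInt_of_continuous _ _ _ (beta_comp_continuous g Hg))) as E2.
  unfold minus, plus, opp in E1, E2; simpl in E1, E2.
  assert (E3 : RInt (fun s => beta s * (f (clamp L s) - g (clamp L s))) 0 (Rmin t x2)
    = RInt (fun s => beta s * f (clamp L s) + - (beta s * g (clamp L s))) 0 (Rmin t x2)).
  { f_equal. apply functional_extensionality. intros s. ring. }
  unfold Rminus in *. rewrite E3, E1, E2. ring.
Qed.

Lemma picard_contract (al : R) (f g : R -> R) (M C : R) :
  (forall x, continuous f x) -> (forall x, continuous g x) -> 0 <= M ->
  C = 2 * (b + (Rabs al + B) * L) ->
  (forall s, 0 <= s <= L -> Rabs (f s - g s) <= M * exp (C * s)) ->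
  forall x, 0 <= x <= L -> Rabs (picard al f x - picard al g x) <= M / 2 * exp (C * x).
Proof.
  intros Hf Hg HM HC Hs x Hx.
  assert (HB : 0 <= B) by (pose proof (Hbeta 0 ltac:(lra)); lra).
  assert (Hq : 0 < b + (Rabs al + B) * L) by (pose proof (Rabs_pos al); nra).
  assert (Hfg : forall x, continuous (fun x => f x - g x) x)
    by (intros; apply (continuous_minus f g); auto).
  replace (M / 2) with ((b + (Rabs al + B) * L) * M / C) by (rewrite HC; field; lra).
  apply (abs_le_of_deriv (fun x => picard al f x - picard al g x)
    (slope al (fun x => f x - g x)) L); [lra| | |nra| |exact Hx].
  - intros y. rewrite slope_minus by assumption.
    apply (is_derive_minus (picard al f) (picard al g)); apply picard_is_derive; assumption.
  - unfold picard. rewrite !RInt_point. ring.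
  - intros y Hy. apply slope_bound; try assumption; lra.
Qed.

Definition is_shot (al : R) (f : R -> R) : Prop :=
  (forall x, continuous f x) /\ forall x, f x = picard al f x.

Fixpoint picard_iter (al : R) (n : nat) : R -> R :=
  match n with O => fun _ => 1 | S n => picard al (picard_iter al n) end.

Lemma picard_iter_continuous al n x : continuous (picard_iter al n) x.
Proof.
  revert x; induction n as [|n IH]; intros x; simpl; [apply continuous_const|].
  apply picard_continuous, IH.
Qed.

Lemma bounded_on_interval (f : R -> R) : (forall x, continuous f x) ->
  exists M, 0 <= M /\ forall x, 0 <= x <= L -> Rabs (f x) <= M.
Proof.
  intros Hf. destruct (continuity_ab_maj (fun x => Rabs (f x)) 0 L) as [xm [Hm _]]; [lra| |].
  - intros c _. apply continuity_pt_filterlim.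
    apply (continuous_comp f Rabs); [apply Hf|apply continuous_Rabs].
  - exists (Rabs (f xm)). split; [apply Rabs_pos|exact Hm].
Qed.

Lemma shot_exists (al : R) :
  exists f, is_shot al f /\ (0 <= al -> forall x, 0 <= x <= L -> 1 <= f x).
Proof.
  set (C := 2 * (b + (Rabs al + B) * L)).
  assert (HB : 0 <= B) by (pose proof (Hbeta 0 ltac:(lra)); lra).
  assert (HC : 0 < C) by (unfold C; pose proof (Rabs_pos al); nra).
  pose proof (picard_iter_continuous al) as Hci.
  assert (Hexp1 : forall s, 0 <= s -> 1 <= exp (C * s))
    by (intros s Hs; pose proof (exp_ineq1_le (C * s)); nra).
  destruct (bounded_on_interval (fun x => picard_iter al 1 x - picard_iter al 0 x)) as [M [HM HM1]].
  { intros x; apply (continuous_minus (picard_iter al 1) (picard_iter al 0)); apply Hci. }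
  assert (Hstep : forall n x, 0 <= x <= L ->
     Rabs (picard_iter al (S n) x - picard_iter al n x) <= M * (1 / 2) ^ n * exp (C * x)).
  { induction n as [|n IH]; intros x Hx.
    - specialize (HM1 x Hx). specialize (Hexp1 x (proj1 Hx)). simpl pow. nra.
    - replace (M * (1 / 2) ^ S n) with (M * (1 / 2) ^ n / 2) by (simpl; field).
      apply (picard_contract al (picard_iter al (S n)) (picard_iter al n)); auto.
      apply Rmult_le_pos; [lra|apply pow_le; lra]. }
  set (K := M * exp (C * L)).
  assert (Hlim : forall x, exists l, forall n,
     Rabs (picard_iter al n (clamp L x) - l) <= 2 * K * (1 / 2) ^ n).
  { intros x. apply (geometric_limit (fun n => picard_iter al n (clamp L x)) K). intros n.
    assert (Hr : 0 <= clamp L x <= L) by (apply clamp_range; lra).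
    eapply Rle_trans; [apply Hstep, Hr|]. unfold K.
    assert (exp (C * clamp L x) <= exp (C * L)) by (apply exp_nondecreasing; nra).
    assert (0 <= (1 / 2) ^ n) by (apply pow_le; lra).
    replace (M * exp (C * L) * (1 / 2) ^ n) with (M * (1 / 2) ^ n * exp (C * L)) by ring.
    apply Rmult_le_compat_l; [apply Rmult_le_pos; assumption|assumption]. }
  pose (F := fun x => proj1_sig (constructive_indefinite_description _ (Hlim x))).
  assert (HF : forall x n, Rabs (picard_iter al n (clamp L x) - F x) <= 2 * K * (1 / 2) ^ n).
  { intros x. exact (proj2_sig (constructive_indefinite_description _ (Hlim x))). }
  assert (HK : 0 <= K) by (unfold K; pose proof (exp_pos (C * L)); nra).
  assert (HcF : forall x, continuous F x).
  { intros x. apply filterlim_locally. intros e.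
    destruct (pow_lt_1_zero (1 / 2) ltac:(rewrite Rabs_pos_eq; lra) (e / 3 / (2 * K + 1))
       ltac:(destruct e; simpl; apply Rdiv_lt_0_compat; lra)) as [N HN].
    specialize (HN N (le_n N)). rewrite Rabs_pos_eq in HN by (apply pow_le; lra).
    apply Rlt_div_r in HN; [|lra].
    assert (Hp : 0 < (1 / 2) ^ N) by (apply pow_lt; lra).
    assert (He : 0 < e / 3) by (destruct e; simpl; lra).
    pose proof (comp_clamp_continuous _ (Hci N) x) as Hc.
    apply (filterlim_locally (fun s => picard_iter al N (clamp L s))) with (eps := mkposreal _ He) in Hc.
    apply filter_imp with (2 := Hc). intros y Hy.
    unfold ball in *; simpl in *; unfold AbsRing_ball, abs, minus, plus, opp in *; simpl in *.
    pose proof (HF x N) as Hx1. pose proof (HF y N) as Hy1.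
    replace (F y + - F x) with ((picard_iter al N (clamp L y) + - picard_iter al N (clamp L x)) +
      (- (picard_iter al N (clamp L y) - F y) + (picard_iter al N (clamp L x) - F x))) by ring.
    eapply Rle_lt_trans; [apply Rabs_triang|].
    eapply Rle_lt_trans; [apply Rplus_le_compat_l, Rabs_triang|]. rewrite Rabs_Ropp. lra. }
  assert (Hfix : forall x, 0 <= x <= L -> picard al F x = F x).
  { intros x Hx. apply Rminus_diag_uniq.
    apply zero_of_geometric_bound with (K * exp (C * L) + K). intros n.
    assert (H1 : Rabs (picard al F x - picard_iter al (S n) x) <= 2 * K * (1 / 2) ^ n / 2 * exp (C * x)).
    { apply (picard_contract al F (picard_iter al n)); auto.
      - apply Rmult_le_pos; [lra|apply pow_le; lra].
      - intros s Hs. specialize (HF s n). rewrite clamp_id in HF by exact Hs.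
        rewrite <- Rabs_Ropp, Ropp_minus_distr.
        eapply Rle_trans; [apply HF|]. specialize (Hexp1 s (proj1 Hs)).
        assert (0 <= 2 * K * (1 / 2) ^ n) by (apply Rmult_le_pos; [lra|apply pow_le; lra]). nra. }
    pose proof (HF x (S n)) as H2. rewrite clamp_id in H2 by exact Hx.
    replace (picard al F x - F x) with ((picard al F x - picard_iter al (S n) x) +
      (picard_iter al (S n) x - F x)) by ring.
    eapply Rle_trans; [apply Rabs_triang|].
    assert (exp (C * x) <= exp (C * L)) by (apply exp_nondecreasing; nra).
    assert (0 <= K * (1 / 2) ^ n) by (apply Rmult_le_pos; [lra|apply pow_le; lra]).
    simpl pow in H2. nra. }
  assert (Hcl : (fun s => picard al F (clamp L s)) = (fun s => F (clamp L s))).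
  { apply functional_extensionality. intros s. apply Hfix, clamp_range. lra. }
  exists (picard al F). split.
  - split; [intros; apply picard_continuous, HcF|].
    assert (Hcl' : (fun s => beta s * picard al F (clamp L s)) = (fun s => beta s * F (clamp L s))).
    { apply functional_extensionality. intros s. rewrite Hfix; [reflexivity|apply clamp_range; lra]. }
    assert (Hsl : slope al (picard al F) = slope al F).
    { apply functional_extensionality. intros t. unfold slope, flux.
      rewrite Hcl, Hcl', Hfix by (apply clamp_range; lra). reflexivity. }
    intros x. unfold picard at 2. rewrite Hsl. reflexivity.
  - intros Hal. apply picard_ge_1; auto. intros s Hs.
    assert (Hi : forall n y, 0 <= y <= L -> 0 <= picard_iter al n y).
    { induction n as [|n IH]; intros y Hy; simpl; [lra|].
      apply Rle_trans with 1; [lra|]. apply picard_ge_1; auto. }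
    destruct (Rle_dec 0 (F s)) as [|Hn]; [assumption|exfalso].
    assert (F s = 0); [|lra]. apply zero_of_geometric_bound with (2 * K). intros n.
    specialize (HF s n). rewrite clamp_id in HF by exact Hs. specialize (Hi n s Hs).
    rewrite Rabs_left by lra. rewrite Rabs_pos_eq in HF by lra. lra.
Qed.

Lemma shot_C1 al f : is_shot al f -> is_C1 f (slope al f).
Proof.
  intros [Hf He] x. split; [|apply slope_continuous, Hf].
  apply is_derive_ext with (picard al f); [intros; symmetry; apply He|apply picard_is_derive, Hf].
Qed.

Lemma shot_0 al f : is_shot al f -> f 0 = 1.
Proof. intros [_ He]. rewrite He. unfold picard. rewrite RInt_point. apply Rplus_0_r. Qed.

Lemma shot_solves al f : is_shot al f ->
  solves 1 b (fun x => al + if Rlt_dec x x2 then beta x else 0) x2 0 L f (slope al f).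
Proof.
  intros H x Hx Hn. rewrite Rdiv_1_r.
  apply slope_is_derive; [apply H|apply (shot_C1 al f H)|exact Hx|exact Hn].
Qed.

Lemma shot_dependence al0 f0 : is_shot al0 f0 ->
  exists Q, 0 < Q /\ forall al f, Rabs (al - al0) <= 1 -> is_shot al f ->
    forall x, 0 <= x <= L -> Rabs (f x - f0 x) <= Q * Rabs (al - al0) /\
      Rabs (slope al f x - slope al0 f0 x) <= Q * Rabs (al - al0).
Proof.
  intros H0.
  assert (HB : 0 <= B) by (pose proof (Hbeta 0 ltac:(lra)); lra).
  destruct (bounded_on_interval f0 (proj1 H0)) as [M0 [HM0 Hf0]].
  set (K := b + (Rabs al0 + 1 + B) * L).
  assert (HK : 0 < K) by (unfold K; pose proof (Rabs_pos al0); nra).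
  set (C := 2 * K). assert (HC : 0 < C) by (unfold C; lra).
  set (N := L * M0). assert (HN : 0 <= N) by (unfold N; nra).
  pose proof (exp_pos (C * L)) as HeL.
  assert (HNC : 0 <= 2 * N / C) by (apply Rdiv_le_0_compat; lra).
  exists ((2 * N / C + 2 * N + 1) * exp (C * L)).
  split; [apply Rmult_lt_0_compat; lra|].
  intros al f Hal H.
  set (D := Rabs (al - al0)) in *. assert (HD : 0 <= D) by apply Rabs_pos.
  assert (Hce : forall x, continuous (fun x => f x - f0 x) x).
  { intros x; apply (continuous_minus f f0); [apply H|apply H0]. }
  destruct (continuity_ab_maj (fun x => Rabs (f x - f0 x) * exp (- C * x)) 0 L) as [xm [Hm Hxm]]; [lra| |].
  { intros c _. apply continuity_pt_filterlim.
    apply (continuous_mult (fun x => Rabs (f x - f0 x)) (fun x => exp (- C * x)));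
      [|apply exp_scal_continuous].
    apply (continuous_comp (fun x => f x - f0 x) Rabs); [apply Hce|apply continuous_Rabs]. }
  set (S := Rabs (f xm - f0 xm) * exp (- C * xm)) in *.
  assert (HS : 0 <= S) by (apply Rmult_le_pos; [apply Rabs_pos|left; apply exp_pos]).
  assert (Hexp : forall x, exp (- C * x) * exp (C * x) = 1).
  { intros x. rewrite <- exp_plus. replace (- C * x + C * x) with 0 by ring. apply exp_0. }
  assert (HeS : forall x, 0 <= x <= L -> Rabs (f x - f0 x) <= S * exp (C * x)).
  { intros x Hx. specialize (Hm x Hx). pose proof (Hexp x) as E. pose proof (exp_pos (C * x)).
    replace (Rabs (f x - f0 x)) with (Rabs (f x - f0 x) * exp (- C * x) * exp (C * x))
      by (rewrite Rmult_assoc, E; ring).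
    apply Rmult_le_compat_r; lra. }
  assert (Hsd : forall x, slope al f x - slope al0 f0 x
      = slope al (fun x => f x - f0 x) x + (al - al0) * RInt (fun s => f0 (clamp L s)) 0 x).
  { intros x. rewrite slope_minus by (apply H || apply H0). unfold slope, flux. ring. }
  assert (Hsb : forall x, 0 <= x <= L ->
     Rabs (slope al f x - slope al0 f0 x) <= (K * S + D * N) * exp (C * x)).
  { intros x Hx. rewrite Hsd. eapply Rle_trans; [apply Rabs_triang|].
    assert (A1 : Rabs (slope al (fun x => f x - f0 x) x) <= K * S * exp (C * x)).
    { eapply Rle_trans; [apply (slope_bound al _ Hce S C); [lra|exact HS|exact HeS|exact Hx]|].
      apply Rmult_le_compat_r; [left; apply exp_pos|].
      apply Rmult_le_compat_r; [exact HS|]. unfold K.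
      assert (Rabs al <= Rabs al0 + 1).
      { replace al with (al0 + (al - al0)) by ring.
        eapply Rle_trans; [apply Rabs_triang|]. fold D; lra. }
      nra. }
    assert (A2 : Rabs (RInt (fun s => f0 (clamp L s)) 0 x) <= N).
    { eapply Rle_trans; [apply (abs_RInt_le_const (fun s => f0 (clamp L s)) 0 x M0); [lra| |]|].
      - apply ex_RInt_of_continuous, comp_clamp_continuous, H0.
      - intros s Hs. apply Hf0, clamp_range. lra.
      - unfold N. nra. }
    rewrite Rabs_mult. fold D.
    assert (D * Rabs (RInt (fun s => f0 (clamp L s)) 0 x) <= D * N)
      by (apply Rmult_le_compat_l; assumption).
    pose proof (exp_ineq1_le (C * x)). assert (1 <= exp (C * x)) by nra.
    assert (0 <= D * N) by nra. nra. }
  assert (He : forall x, 0 <= x <= L -> Rabs (f x - f0 x) <= (K * S + D * N) / C * exp (C * x)).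
  { intros x Hx. apply (abs_le_of_deriv (fun x => f x - f0 x)
      (fun x => slope al f x - slope al0 f0 x) L); [exact HC| | |nra|exact Hsb|exact Hx].
    - intros y. apply (is_derive_minus f f0); [apply (shot_C1 al f H)|apply (shot_C1 al0 f0 H0)].
    - rewrite (shot_0 al f H), (shot_0 al0 f0 H0). ring. }
  assert (HSb : S <= 2 * N / C * D).
  { pose proof (He xm Hxm) as E. pose proof (Hexp xm) as E1. pose proof (exp_pos (- C * xm)).
    assert (S <= (K * S + D * N) / C).
    { unfold S at 1.
      replace ((K * S + D * N) / C) with ((K * S + D * N) / C * exp (C * xm) * exp (- C * xm))
        by (rewrite Rmult_assoc, (Rmult_comm (exp (C * xm))), E1; ring).
      apply Rmult_le_compat_r; lra. }
    replace ((K * S + D * N) / C) with (S / 2 + N / C * D) in H2 by (unfold C; field; lra).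
    replace (2 * N / C * D) with (2 * (N / C * D)) by (field; lra). lra. }
  intros x Hx.
  assert (Hex : exp (C * x) <= exp (C * L)) by (apply exp_nondecreasing; nra).
  assert (HKS : K * S <= D * N).
  { apply Rle_trans with (K * (2 * N / C * D)); [nra|]. right. unfold C; field; lra. }
  split.
  - eapply Rle_trans; [apply HeS, Hx|]. apply Rle_trans with (S * exp (C * L)); [nra|].
    replace ((2 * N / C + 2 * N + 1) * exp (C * L) * D)
      with ((2 * N / C * D + (2 * N + 1) * D) * exp (C * L)) by ring.
    apply Rmult_le_compat_r; [lra|]. nra.
  - eapply Rle_trans; [apply Hsb, Hx|].
    apply Rle_trans with ((K * S + D * N) * exp (C * L)); [apply Rmult_le_compat_l; nra|].
    replace ((2 * N / C + 2 * N + 1) * exp (C * L) * D)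
      with ((2 * N / C * D + (2 * N + 1) * D) * exp (C * L)) by ring.
    apply Rmult_le_compat_r; [lra|]. assert (0 <= 2 * N / C * D) by nra. nra.
Qed.

Definition good_shot (al : R) : Prop :=
  exists f, is_shot al f /\ (forall x, 0 <= x <= L -> 0 < f x) /\ 0 < slope al f L.

Lemma good_shot_0 : good_shot 0.
Proof.
  destruct (shot_exists 0) as [f [Hf H1]]. specialize (H1 (Rle_refl 0)). exists f.
  split; [exact Hf|]. split; [intros x Hx; specialize (H1 x Hx); lra|].
  apply Rlt_le_trans with (b * f L).
  - pose proof (H1 L ltac:(lra)). nra.
  - apply slope_nonneg; [apply Hf|lra| |lra]. intros s Hs; specialize (H1 s Hs); lra.
Qed.

Lemma good_shot_lower al : good_shot al -> - B - b * exp (b * L) / L <= al.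
Proof.
  intros (f & Hf & Hpos & Hsl). apply Rnot_lt_le. intros Hlt.
  set (N := b * exp (b * L) / L) in *.
  assert (HN : 0 < N) by (apply Rdiv_lt_0_compat; [apply Rmult_lt_0_compat; [lra|apply exp_pos]|lra]).
  pose (P := fun x => slope al f x - b * f x).
  pose (k := fun x => al + if Rlt_dec x x2 then beta x else 0).
  assert (HcP : forall x, continuous P x).
  { intros x. apply (continuous_minus (slope al f) (fun x => b * f x));
      [apply slope_continuous, Hf|].
    apply (continuous_mult (fun _ => b) f); [apply continuous_const|apply Hf]. }
  assert (HP : forall x, 0 < x < L -> x <> x2 -> is_derive P x (k x * f x)).
  { intros x Hx Hn. eapply is_derive_eq.
    - apply (is_derive_minus (slope al f) (fun x => b * f x)).
      + apply (shot_solves al f Hf x Hx Hn).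
      + apply (is_derive_scal f x b). apply (shot_C1 al f Hf).
    - unfold minus, plus, opp, k; simpl. field. }
  assert (Hk : forall x, 0 <= x <= L -> k x <= - N).
  { intros x Hx. unfold k. pose proof (Hbeta x Hx). destruct (Rlt_dec x x2); lra. }
  assert (HP0 : P 0 = 0) by (unfold P; rewrite slope_0; ring).
  assert (HPn : forall x, 0 <= x <= L -> P x <= 0).
  { intros x Hx.
    assert (- P 0 <= - P x); [|lra].
    apply (nondecreasing_off_point (fun y => - P y) (fun y => - (k y * f y)) x2); [lra| |].
    - intros y _. apply (continuous_opp P), HcP.
    - intros y Hy Hn. split; [apply (is_derive_opp P), HP; lra|].
      pose proof (Hk y ltac:(lra)). pose proof (Hpos y ltac:(lra)). nra. }
  assert (Hfl : forall x, 0 <= x <= L -> f L * exp (- b * L) <= f x).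
  { intros x Hx.
    assert (Hm : - (f x * exp (- b * x)) <= - (f L * exp (- b * L))).
    { apply (nondecreasing_of_deriv (fun y => - (f y * exp (- b * y)))
        (fun y => - (P y * exp (- b * y)))); [lra| |].
      - intros y _. apply (continuous_opp (fun y => f y * exp (- b * y))).
        apply (continuous_mult f); [apply Hf|apply exp_scal_continuous].
      - intros y Hy. split.
        + eapply is_derive_eq.
          * apply (is_derive_opp (fun y => f y * exp (- b * y))).
            apply (is_derive_mult f (fun y => exp (- b * y)));
              [apply (shot_C1 al f Hf)|apply exp_scal_is_derive|intros; apply Rmult_comm].
          * unfold opp, plus, mult, P; simpl. ring.
        + pose proof (HPn y ltac:(lra)). pose proof (exp_pos (- b * y)). nra. }
    assert (exp (- b * x) <= 1) by (rewrite <- exp_0; apply exp_nondecreasing; nra).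
    pose proof (Hpos x Hx). nra. }
  set (c := f L * exp (- b * L)) in *.
  assert (HPL : - P 0 - N * c * 0 <= - P L - N * c * L).
  { apply (nondecreasing_off_point (fun y => - P y - N * c * y) (fun y => - (k y * f y) - N * c) x2); [lra| |].
    - intros y _. apply (continuous_minus (fun y => - P y) (fun y => N * c * y)).
      + apply (continuous_opp P), HcP.
      + eapply is_derive_cont; auto_derive; trivial.
    - intros y Hy Hn. split.
      + apply (is_derive_minus (fun y => - P y) (fun y => N * c * y)).
        * apply (is_derive_opp P), HP; lra.
        * auto_derive; [trivial|ring].
      + pose proof (Hk y ltac:(lra)). pose proof (Hpos y ltac:(lra)). pose proof (Hfl y ltac:(lra)). nra. }
  assert (HNc : N * c * L = b * f L).
  { unfold N, c. replace (b * exp (b * L) / L * (f L * exp (- b * L)) * L)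
      with (b * f L * (exp (b * L) * exp (- b * L))) by (field; lra).
    rewrite <- exp_plus. replace (b * L + - b * L) with 0 by ring. rewrite exp_0. ring. }
  unfold P in HPL at 2. lra.
Qed.

Theorem principal_shot :
  exists al f, is_shot al f /\ (forall x, 0 <= x <= L -> 0 < f x) /\ slope al f L = 0.
Proof.
  destruct (completeness (fun y => good_shot (- y))) as [m [Hub Hlub]].
  { exists (B + b * exp (b * L) / L). intros y Hy. apply good_shot_lower in Hy. lra. }
  { exists 0. rewrite Ropp_0. apply good_shot_0. }
  set (al := - m).
  assert (Hlow : forall a, good_shot a -> al <= a).
  { intros a Ha. assert (- a <= m); [|unfold al; lra]. apply Hub. rewrite Ropp_involutive. exact Ha. }
  assert (Happ : forall e, 0 < e -> exists a, good_shot a /\ al <= a < al + e).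
  { intros e He. apply NNPP. intros Hno. assert (m <= m - e); [|lra].
    apply Hlub. intros y Hy. apply Rnot_lt_le. intros Hlt. apply Hno. exists (- y).
    split; [exact Hy|]. split; [apply Hlow, Hy|unfold al; lra]. }
  destruct (shot_exists al) as [f [Hf _]]. exists al, f. split; [exact Hf|].
  destruct (shot_dependence al f Hf) as [Q [HQ Hdep]].
  assert (Hnn : forall x, 0 <= x <= L -> 0 <= f x /\ 0 <= slope al f L).
  { intros x Hx. assert (HL' : 0 <= L <= L) by lra.
    split; apply Rnot_lt_le; intros Hlt.
    - destruct (Happ (Rmin 1 (- f x / Q))) as (a & (g & Hg & Hgp & Hgs) & Ha).
      { apply Rmin_glb_lt; [lra|apply Rdiv_lt_0_compat; lra]. }
      pose proof (Rmin_l 1 (- f x / Q)). pose proof (Rmin_r 1 (- f x / Q)).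
      assert (Hal : Rabs (a - al) <= 1) by (rewrite Rabs_pos_eq; lra).
      destruct (Hdep a g Hal Hg x Hx) as [D1 _]. rewrite (Rabs_pos_eq (a - al)) in D1 by lra.
      assert (Hl : a - al < - f x / Q) by lra. apply Rlt_div_r in Hl; [|lra].
      pose proof (Hgp x Hx). apply Rabs_le_between in D1. lra.
    - destruct (Happ (Rmin 1 (- slope al f L / Q))) as (a & (g & Hg & Hgp & Hgs) & Ha).
      { apply Rmin_glb_lt; [lra|apply Rdiv_lt_0_compat; lra]. }
      pose proof (Rmin_l 1 (- slope al f L / Q)). pose proof (Rmin_r 1 (- slope al f L / Q)).
      assert (Hal : Rabs (a - al) <= 1) by (rewrite Rabs_pos_eq; lra).
      destruct (Hdep a g Hal Hg L HL') as [_ D1]. rewrite (Rabs_pos_eq (a - al)) in D1 by lra.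
      assert (Hl : a - al < - slope al f L / Q) by lra. apply Rlt_div_r in Hl; [|lra].
      apply Rabs_le_between in D1. lra. }
  assert (HC1 := shot_C1 al f Hf).
  assert (Hpos : forall x, 0 <= x <= L -> 0 < f x).
  { intros x0 Hx0. destruct (Hnn x0 Hx0) as [[|E] HsL]; [assumption|exfalso].
    pose proof (shot_0 al f Hf) as Hf0.
    assert (Hx0' : 0 < x0) by (destruct (proj1 Hx0) as [|E0]; [assumption|rewrite <- E0 in E; lra]).
    assert (Hs0 : slope al f x0 = 0).
    { apply Rle_antisym.
      - apply (lderiv_min f x0 _ x0 Hx0'); [apply is_derive_lderiv, HC1|].
        intros y Hy. rewrite <- E. apply Hnn; lra.
      - destruct (Req_dec x0 L) as [->|Hn]; [exact HsL|].
        apply (rderiv_min f x0 _ (L - x0)); [lra|apply is_derive_rderiv, HC1|].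
        intros y Hy. rewrite <- E. apply Hnn; lra. }
    (* A double zero is excluded by comparing with the positive solution for a larger parameter. *)
    set (al' := Rabs al + 1).
    assert (Hal' : 0 <= al' /\ al < al') by (unfold al'; pose proof (Rabs_pos al); pose proof (Rle_abs al); lra).
    destruct (shot_exists al') as [g [Hg Hg1]]. specialize (Hg1 (proj1 Hal')).
    destruct (proj1 (filterlim_locally f (f 0)) (proj1 Hf 0) (mkposreal (1 / 2) ltac:(lra))) as [e He].
    assert (Hep := cond_pos e).
    set (eta := Rmin (e / 2) (x0 / 2)).
    assert (Heta : 0 < eta) by (apply Rmin_glb_lt; lra).
    assert (eta <= e / 2) by apply Rmin_l. assert (eta <= x0 / 2) by apply Rmin_r.
    assert (Hfp : forall y, 0 <= y <= eta -> 0 < f y).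
    { intros y Hy. specialize (He y). unfold ball in He; simpl in He.
      unfold AbsRing_ball, abs, minus, plus, opp in He; simpl in He.
      assert (Hb2 : Rabs (y + - 0) < e) by (rewrite Rabs_pos_eq; lra).
      specialize (He Hb2). apply Rabs_def2 in He. lra. }
    assert (W1 : wronskian (b / 1) g (slope al' g) f (slope al f) 0
       < wronskian (b / 1) g (slope al' g) f (slope al f) eta).
    { apply (wronskian_increasing 1 b x2 0 eta
        (fun x => al' + if Rlt_dec x x2 then beta x else 0)
        (fun x => al + if Rlt_dec x x2 then beta x else 0)); [lra|apply shot_C1, Hg|exact HC1| | |lra|].
      - intros x Hx Hn. apply (shot_solves al' g Hg); [lra|exact Hn].
      - intros x Hx Hn. apply (shot_solves al f Hf); [lra|exact Hn].
      - intros x Hx Hn. pose proof (Hfp x ltac:(lra)). pose proof (Hg1 x ltac:(lra)).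
        apply Rmult_lt_0_compat; [lra|]. apply Rmult_lt_0_compat; lra. }
    assert (W2 : wronskian (b / 1) g (slope al' g) f (slope al f) eta
       <= wronskian (b / 1) g (slope al' g) f (slope al f) x0).
    { apply (wronskian_nondecreasing 1 b x2 eta x0
        (fun x => al' + if Rlt_dec x x2 then beta x else 0)
        (fun x => al + if Rlt_dec x x2 then beta x else 0)); [lra|apply shot_C1, Hg|exact HC1| | |lra|].
      - intros x Hx Hn. apply (shot_solves al' g Hg); [lra|exact Hn].
      - intros x Hx Hn. apply (shot_solves al f Hf); [lra|exact Hn].
      - intros x Hx Hn. pose proof (proj1 (Hnn x ltac:(lra))). pose proof (Hg1 x ltac:(lra)).
        apply Rmult_le_pos; [lra|]. apply Rmult_le_pos; lra. }
    unfold wronskian in W1 at 1. unfold wronskian in W2 at 2.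
    rewrite !slope_0, Hf0, (shot_0 al' g Hg) in W1. rewrite Hs0, <- E in W2. lra. }
  split; [exact Hpos|].
  destruct (Hnn L ltac:(lra)) as [_ [HsL|E]]; [exfalso|symmetry; exact E].
  destruct (continuity_ab_min f 0 L) as [xm [Hm Hxm]]; [lra| |].
  { intros c _. apply continuity_pt_filterlim, Hf. }
  pose proof (Hpos xm Hxm) as Hc.
  set (c := Rmin (f xm) (slope al f L)).
  assert (Hcp : 0 < c) by (apply Rmin_glb_lt; assumption).
  assert (Hc1 : c <= f xm) by apply Rmin_l. assert (Hc2 : c <= slope al f L) by apply Rmin_r.
  set (e := Rmin 1 (c / 2 / Q)).
  assert (Hep : 0 < e) by (apply Rmin_glb_lt; [lra|apply Rdiv_lt_0_compat; lra]).
  assert (He1 : e <= 1) by apply Rmin_l.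
  assert (He2 : Q * e <= c / 2).
  { assert (He2 : e <= c / 2 / Q) by apply Rmin_r. apply Rle_div_r in He2; lra. }
  destruct (shot_exists (al - e)) as [g [Hg _]].
  assert (HD : Rabs (al - e - al) = e)
    by (replace (al - e - al) with (- e) by ring; rewrite Rabs_Ropp, Rabs_pos_eq; lra).
  assert (Hal : Rabs (al - e - al) <= 1) by lra.
  assert (Hgood : good_shot (al - e)).
  { exists g. split; [exact Hg|]. split.
    - intros x Hx. destruct (Hdep _ g Hal Hg x Hx) as [D1 _]. rewrite HD in D1.
      apply Rabs_le_between in D1. specialize (Hm x Hx). lra.
    - destruct (Hdep _ g Hal Hg L ltac:(lra)) as [_ D1]. rewrite HD in D1.
      apply Rabs_le_between in D1. lra. }
  apply Hlow in Hgood. lra.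
Qed.
End Shooting.

(** * Principal eigenvalues *)

Definition potential (lam r x2 : R) (beta : R -> R) (x : R) : R :=
  lam - r + if Rlt_dec x x2 then beta x else 0.

Definition eigenpair (d a r x2 L : R) (beta : R -> R) (lam : R) (f f1 : R -> R) : Prop :=
  is_C1 f f1 /\ (forall x, 0 <= x <= L -> 0 < f x) /\ d * f1 0 = a * f 0 /\ f1 L = 0 /\
  solves d a (potential lam r x2 beta) x2 0 L f f1.

Lemma eigenpair_exists (d a r x2 L : R) (beta : R -> R) :
  0 < d -> 0 < a -> 0 < L -> 0 < x2 -> (forall x, continuous beta x) ->
  (forall x, 0 <= x <= L -> 0 <= beta x) ->
  exists lam f f1, eigenpair d a r x2 L beta lam f f1.
Proof.
  intros Hd Ha HL Hx2 Hc Hb.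
  assert (Hc' : forall x, continuous (fun x => beta x / d) x).
  { intros x. apply (continuous_mult beta (fun _ => / d)); [apply Hc|apply continuous_const]. }
  destruct (bounded_on_interval L HL (fun x => beta x / d) Hc') as [B [HB HBb]].
  destruct (principal_shot (a / d) L x2 B (fun x => beta x / d)) as (al & f & Hf & Hpos & HfL);
    try assumption.
  { apply Rdiv_lt_0_compat; assumption. }
  { intros x Hx. split; [apply Rdiv_le_0_compat; [apply Hb, Hx|exact Hd]|].
    eapply Rle_trans; [apply Rle_abs|apply HBb, Hx]. }
  exists (d * al + r), f, (slope (a / d) L x2 (fun x => beta x / d) al f).
  split; [|split; [|split; [|split]]].
  - apply (shot_C1 (a / d) L x2 (fun x => beta x / d)); assumption.
  - exact Hpos.
  - rewrite (slope_0 (a / d) L x2) by lra. field; lra.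
  - exact HfL.
  - intros x Hx Hn. eapply is_derive_eq.
    + apply (shot_solves (a / d) L x2 (fun x => beta x / d) Hc' al f Hf); assumption.
    + unfold potential. destruct (Rlt_dec x x2); field; lra.
Qed.

Lemma eigenpair_principal (d a r m x2 L lam : R) (beta wb f f1 : R -> R) :
  0 < d -> 0 < L -> eigenpair d a r x2 L beta lam f f1 ->
  (forall x, 0 <= x < x2 -> beta x = m * wb x) ->
  is_principal_eig d a (fun x => r - m * chi x2 x * wb x) 0 L lam.
Proof.
  intros Hd HL (HC & Hpos & H0 & H1 & Hs) Hb. exists f.
  assert (HD : forall x, Derive f x = f1 x) by (intros; apply is_derive_unique, HC).
  repeat split.
  - exact Hpos.
  - apply continuous_cont_on. intros x. eapply is_derive_cont. apply HC.
  - intros x _. exists (f1 x). apply HC.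
  - exists (x2 :: nil). intros x Hx Hn.
    assert (Hn' : x <> x2) by (intros ->; apply Hn; left; reflexivity).
    assert (Hd1 : is_derive (Derive f) x ((a * f1 x + potential lam r x2 beta x * f x) / d)).
    { apply is_derive_ext with f1; [intros; symmetry; apply HD|apply Hs; assumption]. }
    split; [eexists; exact Hd1|].
    unfold D2. rewrite (is_derive_unique _ _ _ Hd1), HD. unfold potential, chi.
    destruct (Rle_dec 0 x); [|lra].
    destruct (Rlt_dec x x2); [rewrite Hb by lra|]; field; lra.
  - exists (f1 0). split; [apply is_derive_rderiv, HC|lra].
  - rewrite <- H1. apply is_derive_lderiv, HC.
Qed.

Lemma Rmult3_pos (x y z : R) : 0 < x -> 0 < y -> 0 < z -> 0 < x * (y * z).
Proof. intros; apply Rmult_lt_0_compat; [|apply Rmult_lt_0_compat]; assumption. Qed.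

Section Spectrum.
Variables (d a r x2 L : R).
Hypotheses (Hd : 0 < d) (Ha : 0 < a) (Hr : 0 < r) (HL : 0 < L) (Hx2 : 0 < x2) (Hx2L : x2 <= L).

Lemma eigenpair_wronskian_ends (b : R) (be be' : R -> R) (l l' : R) (f f1 g g1 : R -> R) :
  eigenpair d a r x2 L be l f f1 -> eigenpair d a r x2 L be' l' g g1 ->
  wronskian b f f1 g g1 0 = 0 /\ wronskian b f f1 g g1 L = 0.
Proof.
  intros (_ & _ & F0 & F1 & _) (_ & _ & G0 & G1 & _). unfold wronskian.
  rewrite F1, G1.
  assert (E : f1 0 * g 0 - f 0 * g1 0 = 0).
  { apply Rmult_eq_reg_l with d; [|lra].
    replace (d * (f1 0 * g 0 - f 0 * g1 0)) with (d * f1 0 * g 0 - f 0 * (d * g1 0)) by ring.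
    rewrite F0, G0. ring. }
  rewrite E. split; ring.
Qed.

Lemma eigenvalue_strict_mono (be be' : R -> R) (l l' : R) (f f1 g g1 : R -> R) :
  eigenpair d a r x2 L be l f f1 -> eigenpair d a r x2 L be' l' g g1 ->
  (forall x, 0 < x < x2 -> be' x < be x) -> l < l'.
Proof.
  intros Hf Hg Hlt. apply Rnot_le_lt. intros Hle.
  destruct (eigenpair_wronskian_ends (a / d) _ _ _ _ _ _ _ _ Hf Hg) as [E0 E1].
  destruct Hf as (HCf & Hfp & _ & _ & Sf). destruct Hg as (HCg & Hgp & _ & _ & Sg).
  assert (W1 : wronskian (a / d) f f1 g g1 0 < wronskian (a / d) f f1 g g1 x2).
  { apply (wronskian_increasing d a x2 0 x2 (potential l r x2 be) (potential l' r x2 be'));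
      try assumption.
    - intros x Hx Hn; apply Sf; [lra|exact Hn].
    - intros x Hx Hn; apply Sg; [lra|exact Hn].
    - intros x Hx Hn. unfold potential. destruct (Rlt_dec x x2); [|lra].
      specialize (Hlt x Hx). apply Rmult_lt_0_compat; [lra|].
      apply Rmult_lt_0_compat; [apply Hfp|apply Hgp]; lra. }
  assert (W2 : wronskian (a / d) f f1 g g1 x2 <= wronskian (a / d) f f1 g g1 L).
  { apply (wronskian_nondecreasing d a x2 x2 L (potential l r x2 be) (potential l' r x2 be'));
      try assumption.
    - intros x Hx Hn; apply Sf; [lra|exact Hn].
    - intros x Hx Hn; apply Sg; [lra|exact Hn].
    - intros x Hx Hn. unfold potential. destruct (Rlt_dec x x2); [lra|].
      apply Rmult_le_pos; [lra|].
      apply Rmult_le_pos; left; [apply Hfp|apply Hgp]; lra. }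
  lra.
Qed.

Lemma eigenvalue_perturb (be be' : R -> R) (l l' e : R) (f f1 g g1 : R -> R) : 0 <= e ->
  eigenpair d a r x2 L be l f f1 -> eigenpair d a r x2 L be' l' g g1 ->
  (forall x, 0 < x < x2 -> be x <= be' x + e) -> l' - e <= l.
Proof.
  intros He Hf Hg Hle. apply Rnot_lt_le. intros Hlt.
  destruct (eigenpair_wronskian_ends (a / d) _ _ _ _ _ _ _ _ Hg Hf) as [E0 E1].
  destruct Hf as (HCf & Hfp & _ & _ & Sf). destruct Hg as (HCg & Hgp & _ & _ & Sg).
  assert (W1 : wronskian (a / d) g g1 f f1 0 < wronskian (a / d) g g1 f f1 L).
  { apply (wronskian_increasing d a x2 0 L (potential l' r x2 be') (potential l r x2 be));
      try assumption.
    intros x Hx Hn. unfold potential.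
    apply Rmult_lt_0_compat; [|apply Rmult_lt_0_compat; [apply Hgp|apply Hfp]; lra].
    destruct (Rlt_dec x x2) as [Hxx|]; [specialize (Hle x ltac:(lra))|]; lra. }
  lra.
Qed.

Lemma eigenvalue_neg_strong_drift (l : R) (f f1 : R -> R) : 4 * d * r <= a ^ 2 ->
  eigenpair d a r x2 L (fun _ => 0) l f f1 -> l < 0.
Proof.
  intros Har (HC & Hfp & F0 & F1 & Sf). apply Rnot_le_lt. intros Hl.
  pose (c := a / (2 * d)). assert (Hc : 0 < c) by (apply Rdiv_lt_0_compat; lra).
  pose (g := fun x => exp (c * x)). pose (g1 := fun x => c * exp (c * x)).
  assert (W : wronskian (a / d) f f1 g g1 0 <= wronskian (a / d) f f1 g g1 L).
  { apply (wronskian_nondecreasing d a x2 0 L (potential l r x2 (fun _ => 0)) (fun _ => d * c ^ 2 - a * c));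
      try assumption; [| |lra|].
    - intros x. split; [apply exp_scal_is_derive|apply exp_time_continuous].
    - intros x _ _. unfold g1, g. auto_derive; [trivial|]. field; lra.
    - intros x Hx Hn. unfold potential.
      apply Rmult_le_pos; [|apply Rmult_le_pos; left; [apply Hfp; lra|apply exp_pos]].
      replace (d * c ^ 2 - a * c) with (- (a ^ 2 / (4 * d))) by (unfold c; field; lra).
      assert (r <= a ^ 2 / (4 * d)) by (apply Rle_div_r; lra).
      destruct (Rlt_dec x x2); lra. }
  unfold wronskian in W. rewrite F1 in W. unfold g, g1 in W.
  pose proof (Hfp 0 ltac:(lra)). pose proof (Hfp L ltac:(lra)).
  pose proof (exp_pos (- (a / d) * L)). pose proof (exp_pos (c * L)).
  rewrite !Rmult_0_r, !exp_0 in W.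
  assert (E : f1 0 = 2 * c * f 0).
  { apply Rmult_eq_reg_l with d; [|lra]. rewrite F0. unfold c. field; lra. }
  rewrite E in W.
  assert (0 < exp (- (a / d) * L) * (f L * (c * exp (c * L))))
    by (apply Rmult_lt_0_compat; [|apply Rmult_lt_0_compat; [|apply Rmult_lt_0_compat]]; assumption).
  assert (0 < c * f 0) by nra. lra.
Qed.

Section WeakDrift.
Variable s : R.
Hypotheses (Hs : 0 < s) (Has : a ^ 2 + s ^ 2 = 4 * d * r).

Let om := s / (2 * d).
Let del := atan (a / s).

Lemma om_pos : 0 < om. Proof. apply Rdiv_lt_0_compat; lra. Qed.

Lemma om_mult x y : x <= y -> om * x <= om * y.
Proof. intros H. apply Rmult_le_compat_l; [left; apply om_pos|exact H]. Qed.

Lemma del_range : 0 < del < PI / 2.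
Proof.
  split; [|apply atan_bound]. unfold del. rewrite <- atan_0. apply atan_increasing.
  apply Rdiv_lt_0_compat; lra.
Qed.

Lemma cos_del_pos : 0 < cos del.
Proof. pose proof del_range. pose proof PI_RGT_0. apply cos_gt_0; lra. Qed.

Lemma del_polar th : a * cos th - s * sin th = s / cos del * sin (del - th).
Proof.
  pose proof cos_del_pos as Hc.
  assert (Ht : sin del / cos del = a / s) by (change (tan del = a / s); apply tan_atan).
  assert (Hsd : sin del = a / s * cos del) by (rewrite <- Ht; field; lra).
  rewrite sin_minus, Hsd. field; lra.
Qed.

Definition osc (eta x : R) : R := exp (a / (2 * d) * x) * cos (s / (2 * d) * x + eta).
Definition osc1 (eta x : R) : R :=
  exp (a / (2 * d) * x) * ((a * cos (s / (2 * d) * x + eta) - s * sin (s / (2 * d) * x + eta)) / (2 * d)).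

Lemma osc_C1 eta : is_C1 (osc eta) (osc1 eta).
Proof.
  intros x. split.
  - unfold osc, osc1. auto_derive; [trivial|]. field; lra.
  - unfold osc1. eapply is_derive_cont. auto_derive; trivial.
Qed.

Lemma osc_solves eta c y1 y2 : solves d a (fun _ => - r) c y1 y2 (osc eta) (osc1 eta).
Proof.
  intros x _ _. unfold osc, osc1. auto_derive; [trivial|].
  assert (Hrr : r = (a ^ 2 + s ^ 2) / (4 * d)) by (rewrite Has; field; lra). rewrite Hrr.
  field; lra.
Qed.

Lemma osc_nonneg eta x : - (PI / 2) <= om * x + eta <= PI / 2 -> 0 <= osc eta x.
Proof.
  intros H. apply Rmult_le_pos; [left; apply exp_pos|]. apply cos_ge_0; unfold om in H; lra.
Qed.

Lemma osc1_polar eta x :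
  osc1 eta x = exp (a / (2 * d) * x) * (s / cos del / (2 * d)) * sin (del - (om * x + eta)).
Proof. unfold osc1. rewrite del_polar. unfold om. field. pose proof cos_del_pos; lra. Qed.

Lemma osc1_factor_pos x : 0 < exp (a / (2 * d) * x) * (s / cos del / (2 * d)).
Proof.
  pose proof cos_del_pos. apply Rmult_lt_0_compat; [apply exp_pos|].
  repeat apply Rdiv_lt_0_compat; lra.
Qed.

Lemma osc_flux_0 : osc1 (- del) 0 * d = a * osc (- del) 0.
Proof.
  rewrite osc1_polar. unfold osc. rewrite !Rmult_0_r, exp_0, Rplus_0_l, cos_neg.
  replace (del - - del) with (2 * del) by ring. rewrite sin_2a.
  pose proof cos_del_pos as Hc.
  assert (Ht : sin del / cos del = a / s) by (change (tan del = a / s); apply tan_atan).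
  assert (Hsd : sin del = a / s * cos del) by (rewrite <- Ht; field; lra).
  rewrite Hsd. field. lra.
Qed.

Lemma eigenvalue_neg_short (l : R) (f f1 : R -> R) : om * L < 2 * del ->
  eigenpair d a r x2 L (fun _ => 0) l f f1 -> l < 0.
Proof.
  intros HLs (HC & Hfp & F0 & F1 & Sf). apply Rnot_le_lt. intros Hl.
  pose proof om_pos. pose proof del_range.
  assert (W : wronskian (a / d) f f1 (osc (- del)) (osc1 (- del)) 0
     <= wronskian (a / d) f f1 (osc (- del)) (osc1 (- del)) L).
  { apply (wronskian_nondecreasing d a x2 0 L (potential l r x2 (fun _ => 0)) (fun _ => - r));
      try assumption; [apply osc_C1|apply osc_solves|lra|].
    intros x Hx Hn. unfold potential.
    apply Rmult_le_pos; [destruct (Rlt_dec x x2); lra|].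
    apply Rmult_le_pos; [left; apply Hfp; lra|]. apply osc_nonneg.
    pose proof (om_mult 0 x ltac:(lra)). pose proof (om_mult x L ltac:(lra)). lra. }
  assert (E : f1 0 * osc (- del) 0 - f 0 * osc1 (- del) 0 = 0).
  { apply Rmult_eq_reg_l with d; [|lra].
    transitivity (d * f1 0 * osc (- del) 0 - f 0 * (osc1 (- del) 0 * d)); [ring|].
    rewrite F0, osc_flux_0. ring. }
  unfold wronskian in W. rewrite E, F1 in W.
  assert (Hp : 0 < osc1 (- del) L).
  { rewrite osc1_polar. apply Rmult_lt_0_compat; [apply osc1_factor_pos|].
    pose proof (om_mult 0 L ltac:(lra)). apply sin_gt_0; lra. }
  pose proof (Hfp L ltac:(lra)). pose proof (exp_pos (- (a / d) * L)).
  assert (0 < exp (- (a / d) * L) * (f L * osc1 (- del) L))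
    by (apply Rmult3_pos; assumption).
  lra.
Qed.

Lemma eigenvalue_pos_long (l : R) (f f1 : R -> R) : 2 * del < om * L ->
  eigenpair d a r x2 L (fun _ => 0) l f f1 -> 0 < l.
Proof.
  intros HLs (HC & Hfp & F0 & F1 & Sf). apply Rnot_le_lt. intros Hl.
  pose proof om_pos as Hom. pose proof del_range.
  set (X0 := (PI / 2 + del) / om).
  assert (HX0 : om * X0 = PI / 2 + del) by (unfold X0; field; lra).
  set (X := Rmin L X0).
  assert (HXL : X <= L) by apply Rmin_l. assert (HX1 : X <= X0) by apply Rmin_r.
  assert (HXp : 2 * del < om * X) by (unfold X, Rmin; destruct (Rle_dec L X0); lra).
  assert (HX : 0 < X) by nra.
  assert (HXt : om * X <= PI / 2 + del) by nra.
  assert (W : wronskian (a / d) (osc (- del)) (osc1 (- del)) f f1 0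
     <= wronskian (a / d) (osc (- del)) (osc1 (- del)) f f1 X).
  { apply (wronskian_nondecreasing d a x2 0 X (fun _ => - r) (potential l r x2 (fun _ => 0)));
      try assumption; [apply osc_C1|apply osc_solves| |lra|].
    - intros x Hx Hn; apply Sf; [lra|exact Hn].
    - intros x Hx Hn. unfold potential.
      apply Rmult_le_pos; [destruct (Rlt_dec x x2); lra|].
      apply Rmult_le_pos; [apply osc_nonneg|left; apply Hfp; lra].
      pose proof (om_mult 0 x ltac:(lra)). pose proof (om_mult x X ltac:(lra)). lra. }
  assert (E : osc1 (- del) 0 * f 0 - osc (- del) 0 * f1 0 = 0).
  { apply Rmult_eq_reg_l with d; [|lra].
    transitivity (osc1 (- del) 0 * d * f 0 - osc (- del) 0 * (d * f1 0)); [ring|].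
    rewrite F0, osc_flux_0. ring. }
  assert (EX : osc (- del) X * f1 X = 0).
  { unfold X, Rmin. destruct (Rle_dec L X0); [rewrite F1; ring|].
    unfold osc. fold om. rewrite HX0. replace (PI / 2 + del + - del) with (PI / 2) by ring.
    rewrite cos_PI2. ring. }
  unfold wronskian in W. rewrite E, EX in W.
  assert (Hp : osc1 (- del) X < 0).
  { rewrite osc1_polar. replace (del - (om * X + - del)) with (- (om * X - 2 * del)) by ring.
    rewrite sin_neg. pose proof (osc1_factor_pos X) as Hfac.
    assert (0 < sin (om * X - 2 * del)) by (apply sin_gt_0; lra). nra. }
  pose proof (Hfp X ltac:(lra)). pose proof (exp_pos (- (a / d) * X)).
  assert (0 < exp (- (a / d) * X) * (- osc1 (- del) X * f X))
    by (apply Rmult3_pos; lra).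
  lra.
Qed.

Lemma osc1_neumann : osc1 (del - om * L) L = 0.
Proof.
  rewrite osc1_polar. replace (del - (om * L + (del - om * L))) with 0 by ring. rewrite sin_0; ring.
Qed.

Lemma eigenvalue_pos_protection (be : R -> R) (l : R) (f f1 : R -> R) :
  PI / 2 + del <= om * (L - x2) ->
  eigenpair d a r x2 L be l f f1 -> 0 < l.
Proof.
  intros HLs (HC & Hfp & F0 & F1 & Sf). apply Rnot_le_lt. intros Hl.
  pose proof om_pos as Hom. pose proof del_range.
  set (X := L - (PI / 2 + del) / om).
  assert (HX : om * X = om * L - (PI / 2 + del)) by (unfold X; field; lra).
  assert (HXx : x2 <= X) by nra.
  assert (HXL : X < L) by nra.
  set (eta := del - om * L).
  assert (W : wronskian (a / d) (osc eta) (osc1 eta) f f1 X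
     <= wronskian (a / d) (osc eta) (osc1 eta) f f1 L).
  { apply (wronskian_nondecreasing d a x2 X L (fun _ => - r) (potential l r x2 be));
      try assumption; [apply osc_C1|apply osc_solves| |lra|].
    - intros x Hx Hn; apply Sf; [lra|exact Hn].
    - intros x Hx Hn. unfold potential.
      apply Rmult_le_pos; [destruct (Rlt_dec x x2); lra|].
      apply Rmult_le_pos; [apply osc_nonneg; unfold eta|left; apply Hfp; lra].
      pose proof (om_mult X x ltac:(lra)). pose proof (om_mult x L ltac:(lra)). lra. }
  unfold wronskian in W. unfold eta in W at 3 4. rewrite osc1_neumann, F1 in W.
  assert (E : osc eta X = 0).
  { unfold osc. fold om. rewrite HX. unfold eta.
    replace (om * L - (PI / 2 + del) + (del - om * L)) with (- (PI / 2)) by ring.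
    rewrite cos_neg, cos_PI2. ring. }
  assert (Hp : 0 < osc1 eta X).
  { rewrite osc1_polar, HX. unfold eta.
    replace (del - (om * L - (PI / 2 + del) + (del - om * L))) with (PI / 2 + del) by ring.
    apply Rmult_lt_0_compat; [apply osc1_factor_pos|]. apply sin_gt_0; lra. }
  rewrite E in W. pose proof (Hfp X ltac:(lra)). pose proof (exp_pos (- (a / d) * X)).
  assert (0 < exp (- (a / d) * X) * (osc1 eta X * f X))
    by (apply Rmult3_pos; lra).
  lra.
Qed.

Lemma eigenvalue_neg_large_potential : om * (L - x2) < PI / 2 + del ->
  exists N, 0 < N /\ forall (be : R -> R) (l : R) (f f1 : R -> R),
    (forall x, 0 < x < x2 -> N <= be x) -> eigenpair d a r x2 L be l f f1 -> l < 0.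
Proof.
  intros HLs. pose proof om_pos as Hom. pose proof del_range.
  set (eta := del - om * L).
  assert (Hpos : 0 < osc eta x2).
  { apply Rmult_lt_0_compat; [apply exp_pos|]. fold om. pose proof (om_mult x2 L Hx2L). apply cos_gt_0; unfold eta; lra. }
  set (gam := Rabs (osc1 eta x2 / (osc eta x2 * (2 * x2)))).
  assert (Hgam : 0 <= gam) by apply Rabs_pos.
  assert (Hgam1 : osc1 eta x2 <= 2 * gam * x2 * osc eta x2).
  { assert (Hq : osc1 eta x2 / (osc eta x2 * (2 * x2)) <= gam) by apply Rle_abs.
    apply Rle_div_l in Hq; [lra|]. apply Rmult_lt_0_compat; lra. }
  exists (r + d * (2 * gam + 4 * gam ^ 2 * x2 ^ 2)). split.
  { apply Rplus_lt_le_0_compat; [exact Hr|]. apply Rmult_le_pos; [lra|].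
    pose proof (pow2_ge_0 (gam * x2)). rewrite Rpow_mult_distr in H0. lra. }
  intros be l f f1 Hbe (HC & Hfp & F0 & F1 & Sf). apply Rnot_le_lt. intros Hl.
  pose (g := fun x => exp (gam * x ^ 2)). pose (g1 := fun x => 2 * gam * x * exp (gam * x ^ 2)).
  assert (W1 : wronskian (a / d) f f1 g g1 0 <= wronskian (a / d) f f1 g g1 x2).
  { apply (wronskian_nondecreasing d a x2 0 x2 (potential l r x2 be)
      (fun x => d * (2 * gam + 4 * gam ^ 2 * x ^ 2) - 2 * a * gam * x));
      try assumption; [| | |lra|].
    - intros x. split.
      + unfold g, g1. auto_derive; [trivial|]. simpl; ring.
      + unfold g1. eapply is_derive_cont. auto_derive; trivial.
    - intros x Hx Hn; apply Sf; [lra|exact Hn].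
    - intros x _ _. unfold g1, g. auto_derive; [trivial|]. simpl. field; lra.
    - intros x Hx Hn. unfold potential. destruct (Rlt_dec x x2); [|lra].
      specialize (Hbe x Hx).
      apply Rmult_le_pos; [|apply Rmult_le_pos; left; [apply Hfp; lra|apply exp_pos]].
      assert (0 <= a * gam * x) by (apply Rmult_le_pos; [apply Rmult_le_pos|]; lra).
      assert (gam ^ 2 * x ^ 2 <= gam ^ 2 * x2 ^ 2)
        by (apply Rmult_le_compat_l; [apply pow2_ge_0|nra]).
      nra. }
  assert (W2 : wronskian (a / d) f f1 (osc eta) (osc1 eta) x2
     <= wronskian (a / d) f f1 (osc eta) (osc1 eta) L).
  { apply (wronskian_nondecreasing d a x2 x2 L (potential l r x2 be) (fun _ => - r));
      try assumption; [apply osc_C1| |apply osc_solves|].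
    - intros x Hx Hn; apply Sf; [lra|exact Hn].
    - intros x Hx Hn. unfold potential.
      apply Rmult_le_pos; [destruct (Rlt_dec x x2); lra|].
      apply Rmult_le_pos; [left; apply Hfp; lra|]. apply osc_nonneg; unfold eta.
      pose proof (om_mult x2 x ltac:(lra)). pose proof (om_mult x L ltac:(lra)). lra. }
  unfold wronskian in W1, W2. unfold eta in W2 at 3 4. rewrite osc1_neumann, F1 in W2.
  unfold g1, g in W1. rewrite !Rmult_0_r, Rmult_0_l, !exp_0 in W1.
  replace (0 ^ 2) with 0 in W1 by ring. rewrite !Rmult_0_r, exp_0 in W1.
  pose proof (Hfp 0 ltac:(lra)) as Hf0. pose proof (Hfp x2 ltac:(lra)) as Hf2.
  assert (Hf10 : 0 < f1 0).
  { apply Rmult_lt_reg_l with d; [lra|]. rewrite F0, Rmult_0_r. nra. }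
  set (G := exp (gam * x2 ^ 2)) in *. assert (HG : 0 < G) by apply exp_pos.
  set (E := exp (- (a / d) * x2)) in *. assert (HE : 0 < E) by apply exp_pos.
  assert (A1 : 0 < E * (G * (f1 x2 - f x2 * (2 * gam * x2)))) by lra.
  assert (A2 : 0 < f1 x2 - f x2 * (2 * gam * x2)).
  { apply Rmult_lt_reg_l with (E * G); [nra|]. lra. }
  assert (A3 : 0 < E * (f1 x2 * osc eta x2 - f x2 * osc1 eta x2)).
  { apply Rmult_lt_0_compat; [exact HE|]. nra. }
  lra.
Qed.
End WeakDrift.
End Spectrum.

(** * Decay of solutions *)

Lemma cont_on_upper_bound (v : R -> R) (a b : R) :
  a <= b -> cont_on v a b -> exists B, 0 < B /\ forall x, a <= x <= b -> v x <= B.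
Proof.
  intros Hab H.
  destruct (cont_on_lower_bound (fun x => (-1) * v x + 0 * v x) a b Hab) as (B & HB & Hv).
  { apply cont_on_lin; exact H. }
  exists B. split; [exact HB|]. intros x Hx. specialize (Hv x Hx). lra.
Qed.

Lemma is_derive_lin_time (f : R -> R) (p C c W t l : R) :
  is_derive f t l ->
  is_derive (fun s => p * f s + C * exp (c * s) * W) t (p * l + c * (C * exp (c * t) * W)).
Proof.
  intros H. apply (is_derive_plus (fun s => p * f s) (fun s => C * exp (c * s) * W)).
  - apply (is_derive_scal f t p l H).
  - auto_derive; [trivial|ring].
Qed.

Section Stability.
Variables (d1 d2 r m p q h L a1 a2 x2 lam : R) (wb f f1 u0 w0 : R -> R) (u w : R -> R -> R).
Hypotheses (Hd1 : 0 < d1) (Hd2 : 0 < d2) (Hm : 0 < m) (Hp : 0 < p) (Hq : 0 < q)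
  (Hh : 0 < h) (HL : 0 < L) (Ha2 : 0 <= a2) (Hx2 : 0 < x2) (Hx2L : x2 <= L)
  (Hlam : lam < 0) (Hf : eigenpair d1 a1 r x2 L (fun _ => 0) lam f f1)
  (Hwb : is_wbar d2 a2 h q x2 wb)
  (Hcu0 : cont_on u0 0 L) (Hcw0 : cont_on w0 0 x2)
  (Hu0 : forall x, 0 <= x <= L -> 0 <= u0 x) (Hw0 : forall x, 0 <= x <= x2 -> 0 <= w0 x)
  (Hsol : is_solution d1 d2 r m p q h L a1 a2 x2 u0 w0 u w).

Lemma u_has_d2 t x : 0 < t -> 0 < x < L -> x <> x2 -> exists ux uxx ut,
  has_d2 (fun y => u y t) x ux uxx /\ is_derive (fun s => u x s) t ut /\
  ut = d1 * uxx - a1 * ux + u x t * (r - u x t - m * chi x2 x * w x t).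
Proof.
  destruct Hsol as (_ & _ & _ & _ & Hx & Hpde & _ & _). intros Ht Hx0 Hn.
  destruct (Hpde t x Ht Hx0 Hn) as [E1 E2].
  exists (Derive (fun y => u y t) x), (D2 (fun y => u y t) x), (Derive (fun s => u x s) t).
  split; [|split; [apply Derive_correct, (proj2 (Hx t x Ht Hx0))|exact E2]].
  apply has_d2_Derive with 0 L; [exact Hx0| |exact E1]. intros y Hy. exact (proj1 (Hx t y Ht Hy)).
Qed.

Lemma w_has_d2 t x : 0 < t -> 0 < x < x2 -> exists wx wxx wt,
  has_d2 (fun y => w y t) x wx wxx /\ is_derive (fun s => w x s) t wt /\
  wt = d2 * wxx - a2 * wx + h - q * w x t - p * u x t * w x t.
Proof.
  destruct Hsol as (_ & _ & _ & _ & _ & _ & Hpde & _). intros Ht Hx0.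
  destruct (Hpde t x Ht Hx0) as (E1 & E2 & E3 & E4).
  exists (Derive (fun y => w y t) x), (D2 (fun y => w y t) x), (Derive (fun s => w x s) t).
  split; [|split; [apply Derive_correct; assumption|exact E4]].
  apply has_d2_Derive with 0 x2; [exact Hx0| |exact E2]. intros y Hy. exact (proj1 (Hpde t y Ht Hy)).
Qed.

Lemma u_nonneg x t : 0 <= x <= L -> 0 <= t -> 0 <= u x t.
Proof.
  intros Hx Ht. pose proof Hsol as (Hcu & Hcw & Hiu & _ & Hux & _ & _ & Hbc).
  destruct (strip_bound u 0 L t (Rlt_le _ _ HL) Ht Hcu) as (Bu & HBu & Hub).
  destruct (strip_bound w 0 x2 t (Rlt_le _ _ Hx2) Ht Hcw) as (Bw & HBw & Hwlb).
  apply (parabolic_min L t d1 a1 (r + Bu + m * Bw) a1 0 x2 u HL Hd1 Hx2 Hcu);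
    [| | | | |exact Hx|lra].
  - intros y Hy. rewrite Hiu by exact Hy. apply Hu0, Hy.
  - intros s Hs Hi. exact (proj1 (Hux s x2 (proj1 Hs) Hi)).
  - intros s y Hs Hy Hn.
    destruct (u_has_d2 s y ltac:(lra) Hy Hn) as (ux & uxx & ut & E1 & E2 & E3).
    exists ux, uxx, ut. split; [exact E1|]. split; [exact E2|]. intros Hneg. rewrite E3.
    assert (Hc : r - u y s - m * chi x2 y * w y s <= r + Bu + m * Bw).
    { pose proof (Hub y s ltac:(lra) ltac:(lra)). unfold chi.
      destruct (Rle_dec 0 y); [|nra]. destruct (Rlt_dec y x2); [|nra].
      pose proof (Hwlb y s ltac:(lra) ltac:(lra)). nra. }
    nra.
  - intros s Hs. destruct (Hbc s ltac:(lra)) as ((k & Hk & Ek) & _). exists k. split; [exact Hk|lra].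
  - intros s Hs. destruct (Hbc s ltac:(lra)) as (_ & Hk & _). exists 0. split; [exact Hk|lra].
Qed.

Lemma w_nonneg x t : 0 <= x <= x2 -> 0 <= t -> 0 <= w x t.
Proof.
  intros Hx Ht. pose proof Hsol as (_ & Hcw & _ & Hiw & _ & _ & _ & Hbc).
  apply (parabolic_min x2 t d2 a2 0 a2 a2 x2 w Hx2 Hd2 Hx2 Hcw); [| | | | |exact Hx|lra].
  - intros y Hy. rewrite Hiw by exact Hy. apply Hw0, Hy.
  - intros s Hs Hi. lra.
  - intros s y Hs Hy Hn.
    destruct (w_has_d2 s y ltac:(lra) Hy) as (wx & wxx & wt & E1 & E2 & E3).
    exists wx, wxx, wt. split; [exact E1|]. split; [exact E2|]. intros Hneg. rewrite E3.
    pose proof (u_nonneg y s ltac:(lra) ltac:(lra)).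
    assert (0 <= p * u y s) by nra. nra.
  - intros s Hs. destruct (Hbc s ltac:(lra)) as (_ & _ & (k & Hk & Ek) & _).
    exists k. split; [exact Hk|lra].
  - intros s Hs. destruct (Hbc s ltac:(lra)) as (_ & _ & _ & (k & Hk & Ek)).
    exists k. split; [exact Hk|lra].
Qed.

Lemma u_decay : exists C, 0 < C /\
  forall x t, 0 <= x <= L -> 0 <= t -> u x t <= C * exp (lam * t).
Proof.
  destruct Hf as (HC1 & Hfp & F0 & F1 & Sf).
  pose proof Hsol as (Hcu & Hcw & Hiu & _ & Hux & _ & _ & Hbc).
  assert (Hcf : forall x, continuous f x) by (intros x; eapply is_derive_cont; apply HC1).
  destruct (continuity_ab_min f 0 L) as [xm [Hmin Hxm]]; [lra| |].
  { intros c _. apply continuity_pt_filterlim, Hcf. }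
  pose proof (Hfp xm Hxm) as Hc0.
  destruct (bounded_on_interval L HL f Hcf) as [Phi [HPhi HfPhi]].
  destruct (cont_on_upper_bound u0 0 L (Rlt_le _ _ HL) Hcu0) as (B0 & HB0 & Hub).
  pose (C := B0 / f xm). assert (HC : 0 < C) by (apply Rdiv_lt_0_compat; assumption).
  assert (HCf : C * f xm = B0) by (unfold C; field; lra).
  assert (Hz : forall x t, 0 <= x <= L -> 0 <= t -> 0 <= (-1) * u x t + C * exp (lam * t) * f x).
  { intros x t Hx Ht.
    apply (parabolic_min L t d1 a1 r a1 0 x2 (fun x t => (-1) * u x t + C * exp (lam * t) * f x)
      HL Hd1 Hx2); [| | | | | |exact Hx|lra].
    - apply (strip_lin u (fun x _ => f x) (fun t => C * exp (lam * t))); [exact Hcu| |].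
      + intros s; apply exp_time_continuous.
      + apply strip_steady, continuous_cont_on, Hcf.
    - intros y Hy. rewrite Hiu by exact Hy. rewrite Rmult_0_r, exp_0.
      specialize (Hub y Hy). specialize (Hmin y Hy). nra.
    - intros s Hs Hi. destruct (Hux s x2 ltac:(lra) ltac:(lra)) as [[k Hk] _].
      eexists. apply (is_derive_plus (fun y => (-1) * u y s) (fun y => C * exp (lam * s) * f y)).
      + apply (is_derive_scal (fun y => u y s) x2 (-1) k Hk).
      + apply (is_derive_scal f x2 (C * exp (lam * s))). apply HC1.
    - intros s y Hs Hy Hn.
      destruct (u_has_d2 s y ltac:(lra) Hy Hn) as (ux & uxx & ut & E1 & E2 & E3).
      pose proof (Sf y Hy Hn) as E4.
      eexists _, _, _. split; [|split].
      + apply has_d2_lin; [exact E1|]. apply (has_d2_global f f1); [intros; apply HC1|exact E4].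
      + apply is_derive_lin_time, E2.
      + intros _. rewrite E3. unfold potential.
        pose proof (u_nonneg y s ltac:(lra) ltac:(lra)) as Hu.
        assert (Hcw' : 0 <= u y s * (u y s + m * chi x2 y * w y s)).
        { apply Rmult_le_pos; [exact Hu|]. unfold chi.
          destruct (Rle_dec 0 y); [|nra]. destruct (Rlt_dec y x2); [|nra].
          pose proof (w_nonneg y s ltac:(lra) ltac:(lra)). nra. }
        set (e := C * exp (lam * s)) in *.
        set (k := if Rlt_dec y x2 then 0 else 0).
        assert (Hk : k = 0) by (unfold k; destruct (Rlt_dec y x2); reflexivity). rewrite Hk.
        replace (d1 * (-1 * uxx + e * ((a1 * f1 y + (lam - r + 0) * f y) / d1)))
          with (- (d1 * uxx) + e * (a1 * f1 y + (lam - r) * f y)) by (field; lra).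
        lra.
    - intros s Hs. destruct (Hbc s ltac:(lra)) as ((k & Hk & Ek) & _).
      exists ((-1) * k + C * exp (lam * s) * f1 0). split.
      + apply (sided_deriv_lin (at_right 0) (fun y => u y s) f); [exact Hk|].
        apply is_derive_rderiv, HC1.
      + set (e := C * exp (lam * s)).
        replace (d1 * (-1 * k + e * f1 0)) with (- (d1 * k) + e * (d1 * f1 0)) by ring.
        rewrite F0. lra.
    - intros s Hs. destruct (Hbc s ltac:(lra)) as (_ & Hk & _).
      exists ((-1) * 0 + C * exp (lam * s) * f1 L). split.
      + apply (sided_deriv_lin (at_left 0) (fun y => u y s) f); [exact Hk|].
        apply is_derive_lderiv, HC1.
      + rewrite F1. lra. }
  exists (C * (Phi + 1)). split; [nra|]. intros x t Hx Ht. specialize (Hz x t Hx Ht).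
  specialize (HfPhi x Hx). pose proof (Rle_abs (f x)). pose proof (exp_pos (lam * t)).
  assert (0 < C * exp (lam * t)) by nra. nra.
Qed.

Lemma w_compare (sg C c x t : R) : 0 <= C ->
  (forall x, 0 <= x <= x2 -> - C <= sg * (w0 x - wb x)) ->
  (forall x t, 0 <= x <= x2 -> 0 <= t -> sg * (p * u x t * w x t) <= (q - c) * (C * exp (- c * t))) ->
  c <= q -> 0 <= x <= x2 -> 0 <= t ->
  - (C * exp (a2 / d2 * x2)) * exp (- c * t) <= sg * (w x t - wb x).
Proof.
  intros HC Hini Hsrc Hcq Hx Ht.
  pose proof Hsol as (_ & Hcw & _ & Hiw & _ & _ & _ & Hbc).
  assert (Had : 0 <= a2 / d2) by (apply Rdiv_le_0_compat; lra).
  assert (HE1 : forall y, 0 <= y -> 1 <= exp (a2 / d2 * y)).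
  { intros y Hy. pose proof (exp_ineq1_le (a2 / d2 * y)).
    assert (0 <= a2 / d2 * y) by (apply Rmult_le_pos; assumption). lra. }
  pose (y := fun x t => 1 * w x t + (-1) * wb x).
  assert (Hz : 0 <= sg * y x t + C * exp (- c * t) * exp (a2 / d2 * x)).
  { apply (parabolic_min x2 t d2 a2 0 a2 a2 x2
      (fun x t => sg * y x t + C * exp (- c * t) * exp (a2 / d2 * x)) Hx2 Hd2 Hx2);
      [| | | | | |exact Hx|lra].
    - apply (strip_lin y (fun x _ => exp (a2 / d2 * x)) (fun t => C * exp (- c * t)));
        [|intros s; apply exp_time_continuous|].
      + apply (strip_lin w (fun x _ => wb x) (fun _ => -1)); [exact Hcw| |].
        * intros s; apply continuous_const.
        * apply strip_steady, Hwb.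
      + apply strip_steady, continuous_cont_on. intros; apply exp_scal_continuous.
    - intros v Hv. unfold y. rewrite Hiw by exact Hv. rewrite Rmult_0_r, exp_0.
      specialize (Hini v Hv). specialize (HE1 v (proj1 Hv)). nra.
    - intros s Hs Hi; lra.
    - intros s v Hs Hv _.
      destruct (w_has_d2 s v ltac:(lra) Hv) as (wx & wxx & wt & E1 & E2 & E3).
      destruct (wbar_has_d2 _ _ _ _ _ _ Hwb v Hv) as [E4 E5].
      eexists _, _, _. split; [|split].
      + apply has_d2_lin; [|apply exp_scal_has_d2].
        apply (has_d2_lin (fun v => w v s) wb); [exact E1|exact E4].
      + apply is_derive_lin_time. unfold y.
        apply (is_derive_plus (fun s => 1 * w v s) (fun _ => -1 * wb v)).
        * apply (is_derive_scal (fun s => w v s) s 1 wt E2).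
        * apply (is_derive_const (-1 * wb v)).
      + intros Hneg. specialize (Hsrc v s ltac:(lra) ltac:(lra)). specialize (HE1 v ltac:(lra)).
        set (e := C * exp (- c * s)) in *.
        assert (He : 0 <= e) by (apply Rmult_le_pos; [exact HC|left; apply exp_pos]).
        set (W := exp (a2 / d2 * v)) in *.
        assert (Hsrc' : sg * (p * u v s * w v s) <= (q - c) * (e * W)).
        { apply Rle_trans with (1 := Hsrc). apply Rmult_le_compat_l; nra. }
        unfold y in *. change (plus (1 * wt) zero) with (1 * wt + 0).
        replace (d2 * (sg * (1 * wxx + -1 * D2 wb v) + e * ((a2 / d2) ^ 2 * W)) -
           a2 * (sg * (1 * wx + -1 * Derive wb v) + e * (a2 / d2 * W)))
          with (sg * ((d2 * wxx - a2 * wx) - (d2 * D2 wb v - a2 * Derive wb v))) by (field; lra).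
        replace (d2 * wxx - a2 * wx) with (wt - h + q * w v s + p * u v s * w v s) by lra.
        replace (d2 * D2 wb v - a2 * Derive wb v) with (q * wb v - h) by lra.
        assert (0 <= q * - (sg * (1 * w v s + -1 * wb v) + e * W)) by (apply Rmult_le_pos; lra).
        lra.
    - intros s Hs. destruct (Hbc s ltac:(lra)) as (_ & _ & Hk & _).
      destruct Hwb as (_ & _ & _ & Hk' & _).
      destruct (flux_lin_right d2 a2 0 sg (C * exp (- c * s)) (fun v => y v s)
        (fun v => exp (a2 / d2 * v))) as (k & K1 & K2).
      + apply (flux_lin_right d2 a2 0 1 (-1) (fun v => w v s) wb); assumption.
      + apply exp_flux_right, Hd2.
      + exists k. split; [exact K1|lra].
    - intros s Hs. destruct (Hbc s ltac:(lra)) as (_ & _ & _ & Hk).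
      destruct Hwb as (_ & _ & _ & _ & Hk').
      destruct (flux_lin_left d2 a2 x2 sg (C * exp (- c * s)) (fun v => y v s)
        (fun v => exp (a2 / d2 * v))) as (k & K1 & K2).
      + apply (flux_lin_left d2 a2 x2 1 (-1) (fun v => w v s) wb); assumption.
      + apply exp_flux_left, Hd2.
      + exists k. split; [exact K1|lra]. }
  unfold y in Hz.
  assert (exp (a2 / d2 * x) <= exp (a2 / d2 * x2)) by (apply exp_nondecreasing; nra).
  assert (0 <= C * exp (- c * t)) by (apply Rmult_le_pos; [exact HC|left; apply exp_pos]).
  nra.
Qed.

Lemma solution_converges eps : 0 < eps -> exists T, forall t, T < t ->
  (forall x, 0 <= x <= L -> Rabs (u x t) < eps) /\
  (forall x, 0 <= x <= x2 -> Rabs (w x t - wb x) < eps).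
Proof.
  intros Heps.
  destruct u_decay as (C & HC & Hu).
  destruct (cont_on_lower_bound (fun x => 1 * w0 x + (-1) * wb x) 0 x2) as (B1 & HB1 & Hb1); [lra| |].
  { apply cont_on_lin; [exact Hcw0|apply Hwb]. }
  destruct (cont_on_upper_bound (fun x => 1 * w0 x + (-1) * wb x) 0 x2) as (B2 & HB2 & Hb2); [lra| |].
  { apply cont_on_lin; [exact Hcw0|apply Hwb]. }
  destruct (cont_on_upper_bound wb 0 x2) as (B3 & HB3 & Hb3); [lra|apply Hwb|].
  set (W := exp (a2 / d2 * x2)). assert (HW : 0 < W) by apply exp_pos.
  assert (Hup : forall x t, 0 <= x <= x2 -> 0 <= t -> w x t - wb x <= B2 * W * exp (- q * t)).
  { intros x t Hx Ht.
    pose proof (w_compare (-1) B2 q x t (Rlt_le _ _ HB2)) as H. fold W in H.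
    assert (- (B2 * W) * exp (- q * t) <= -1 * (w x t - wb x)); [|lra].
    apply H; [| |lra|exact Hx|exact Ht].
    - intros y Hy. specialize (Hb2 y Hy). lra.
    - intros y s Hy Hs. pose proof (u_nonneg y s ltac:(lra) Hs). pose proof (w_nonneg y s Hy Hs).
      assert (0 <= p * u y s * w y s) by (repeat apply Rmult_le_pos; lra). lra. }
  set (M := B3 + B2 * W). assert (HM : 0 < M) by (unfold M; nra).
  assert (HwM : forall x t, 0 <= x <= x2 -> 0 <= t -> w x t <= M).
  { intros x t Hx Ht. specialize (Hup x t Hx Ht). specialize (Hb3 x Hx).
    assert (exp (- q * t) <= 1) by (rewrite <- exp_0; apply exp_nondecreasing; nra).
    unfold M. assert (0 < B2 * W) by nra. nra. }
  set (c := Rmin (- lam) (q / 2)).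
  assert (Hc1 : c <= - lam) by apply Rmin_l. assert (Hc2 : c <= q / 2) by apply Rmin_r.
  assert (Hc : 0 < c) by (apply Rmin_glb_lt; lra).
  set (K := p * C * M). assert (HK : 0 < K) by (unfold K; repeat apply Rmult_lt_0_compat; assumption).
  set (C2 := B1 + K / (q / 2)).
  assert (HKq : 0 < K / (q / 2)) by (apply Rdiv_lt_0_compat; lra).
  assert (HC2 : 0 < C2) by (unfold C2; lra).
  assert (Hlo : forall x t, 0 <= x <= x2 -> 0 <= t -> - (C2 * W) * exp (- c * t) <= w x t - wb x).
  { intros x t Hx Ht.
    pose proof (w_compare 1 C2 c x t (Rlt_le _ _ HC2)) as H. fold W in H.
    rewrite <- (Rmult_1_l (w x t - wb x)).
    apply H; [| |lra|exact Hx|exact Ht].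
    - intros y Hy. specialize (Hb1 y Hy). unfold C2. lra.
    - intros y s Hy Hs. pose proof (u_nonneg y s ltac:(lra) Hs) as U0. pose proof (w_nonneg y s Hy Hs) as W0.
      pose proof (Hu y s ltac:(lra) Hs) as U1. pose proof (HwM y s Hy Hs) as W1.
      assert (HE : exp (lam * s) <= exp (- c * s)) by (apply exp_nondecreasing; nra).
      pose proof (exp_pos (- c * s)) as HE0.
      assert (U2 : u y s <= C * exp (- c * s)) by (eapply Rle_trans; [exact U1|nra]).
      assert (A1 : u y s * w y s <= C * exp (- c * s) * M) by (apply Rmult_le_compat; assumption).
      assert (A2 : K <= (q - c) * C2).
      { apply Rle_trans with (q / 2 * (K / (q / 2))); [right; field; lra|].
        apply Rmult_le_compat; unfold C2; lra. }
      replace (1 * (p * u y s * w y s)) with (p * (u y s * w y s)) by ring.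
      apply Rle_trans with (K * exp (- c * s)); [unfold K; nra|]. nra. }
  destruct (exp_decay (C + B2 * W + C2 * W) c eps Hc Heps) as [T HT].
  exists (Rmax T 0). intros t Ht.
  assert (Ht0 : 0 < t) by (eapply Rle_lt_trans; [apply Rmax_r|exact Ht]).
  specialize (HT t (Rle_lt_trans _ _ _ (Rmax_l T 0) Ht)).
  pose proof (exp_pos (- c * t)) as HE0.
  assert (0 < B2 * W) by nra. assert (0 < C2 * W) by nra.
  split; intros x Hx.
  - pose proof (u_nonneg x t Hx ltac:(lra)). rewrite Rabs_pos_eq by assumption.
    specialize (Hu x t Hx ltac:(lra)).
    assert (exp (lam * t) <= exp (- c * t)) by (apply exp_nondecreasing; nra).
    nra.
  - specialize (Hup x t Hx ltac:(lra)). specialize (Hlo x t Hx ltac:(lra)).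
    assert (exp (- q * t) <= exp (- c * t)) by (apply exp_nondecreasing; nra).
    apply Rabs_def1; nra.
Qed.
End Stability.

(** * Critical lengths and thresholds *)

Section CriticalLengths.
Variables (d a r s : R).
Hypotheses (Ha : 0 < a) (Hs : 0 < s) (Has : a ^ 2 + s ^ 2 = 4 * d * r)
  (Es : sqrt (4 * d * r - a ^ 2) = s).

Lemma Lstar_eq : Lstar d a r = 2 * d * (PI / 2 + atan (a / s)) / s.
Proof.
  unfold Lstar. rewrite Es.
  replace (s / a) with (/ (a / s)) by (field; lra).
  rewrite atan_inv by (apply Rdiv_lt_0_compat; lra). field; lra.
Qed.

Lemma tan_double_angle : a <> s -> cos (2 * atan (a / s)) <> 0 ->
  tan (2 * atan (a / s)) = a * s / (2 * d * r - a ^ 2).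
Proof.
  intros Hn Hc. assert (H2 : s ^ 2 - a ^ 2 <> 0) by nra.
  assert (H1 : 1 - a / s * (a / s) <> 0).
  { intro E. apply H2. replace (s ^ 2 - a ^ 2) with ((1 - a / s * (a / s)) * s ^ 2) by (field; lra).
    rewrite E; ring. }
  assert (Hc1 : cos (atan (a / s)) <> 0).
  { pose proof (atan_bound (a / s)). apply Rgt_not_eq, cos_gt_0; lra. }
  rewrite tan_2a by (rewrite ?tan_atan; assumption). rewrite tan_atan.
  replace (2 * d * r - a ^ 2) with ((s ^ 2 - a ^ 2) / 2) by lra.
  field. repeat split; try lra; try assumption.
Qed.

Lemma L1star_eq : L1star d a r = 2 * d * (2 * atan (a / s)) / s.
Proof.
  unfold L1star. cbv zeta. rewrite Es.
  pose proof PI_RGT_0 as HPI.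
  assert (Hdr : 0 < 2 * d * r) by nra.
  pose proof (sqrt_lt_R0 _ Hdr) as Hsq. pose proof (sqrt_sqrt _ (Rlt_le _ _ Hdr)) as Hss.
  set (q := sqrt (2 * d * r)) in *.
  pose proof (atan_bound (a / s)) as Hab.
  assert (Hat0 : 0 < atan (a / s)).
  { rewrite <- atan_0. apply atan_increasing, Rdiv_lt_0_compat; lra. }
  destruct (Rlt_dec a q) as [Hlt|Hge]; [|destruct (Req_EM_T a q) as [Heq|Hne]].
  - assert (Has' : a < s) by nra.
    assert (atan (a / s) < PI / 4).
    { rewrite <- atan_1. apply atan_increasing. apply Rlt_div_l; lra. }
    rewrite <- tan_double_angle; [|lra|apply Rgt_not_eq, cos_gt_0; lra].
    rewrite atan_tan by lra. reflexivity.
  - assert (a = s) by nra. replace (a / s) with 1 by (rewrite H; field; lra).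
    rewrite atan_1. field; lra.
  - assert (Has' : s < a) by nra.
    assert (PI / 4 < atan (a / s)).
    { rewrite <- atan_1. apply atan_increasing. apply Rlt_div_r; lra. }
    rewrite <- tan_double_angle; [|lra|apply Rlt_not_eq, cos_lt_0; lra].
    assert (Hc : cos (2 * atan (a / s) - PI) <> 0).
    { apply Rgt_not_eq, cos_gt_0; lra. }
    replace (2 * atan (a / s)) with (PI + (2 * atan (a / s) - PI)) at 1 by ring.
    rewrite Rtrigo_facts.tan_pi_plus by exact Hc. rewrite atan_tan by lra. field; lra.
Qed.
End CriticalLengths.

Lemma weak_drift (d a r : R) : 0 < d -> 0 < r -> 0 < a -> a < sqrt (4 * d * r) ->
  0 < sqrt (4 * d * r - a ^ 2) /\ a ^ 2 + sqrt (4 * d * r - a ^ 2) ^ 2 = 4 * d * r.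
Proof.
  intros Hd Hr Ha H. assert (H4 : 0 <= 4 * d * r) by nra.
  pose proof (sqrt_sqrt _ H4). assert (Hp : 0 < 4 * d * r - a ^ 2) by nra.
  split; [apply sqrt_lt_R0, Hp|].
  pose proof (sqrt_sqrt _ (Rlt_le _ _ Hp)). nra.
Qed.

Lemma strong_drift (d a r : R) : 0 < d -> 0 < r -> a >= sqrt (4 * d * r) -> 4 * d * r <= a ^ 2.
Proof.
  intros Hd Hr H. assert (H4 : 0 <= 4 * d * r) by nra.
  pose proof (sqrt_sqrt _ H4). pose proof (sqrt_pos (4 * d * r)). nra.
Qed.

Lemma clamp_comp_continuous (v : R -> R) (l : R) : 0 <= l -> cont_on v 0 l ->
  forall x, continuous (fun y => v (clamp l y)) x.
Proof.
  intros Hl Hv x P HP.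
  pose proof (Hv (clamp l x) (clamp_range l x Hl) P HP) as H. unfold filtermap, within in H.
  pose proof (clamp_continuous l x _ H) as H2. unfold filtermap in *.
  apply filter_imp with (2 := H2). intros y Hy. apply Hy, clamp_range, Hl.
Qed.

Definition wbar_eigenvalue (d1 a1 r L x2 m : R) (wb : R -> R) (lam : R) : Prop :=
  exists f f1, eigenpair d1 a1 r x2 L (fun x => m * wb (clamp x2 x)) lam f f1.

(* The supremum of a set of positive reals, with [0] for the empty set. *)
Lemma positive_threshold (S : R -> Prop) (B : R) : (forall y, S y -> y <= B) ->
  exists M, (forall y, M < y -> ~ S y) /\ (forall y, 0 < y -> y < M -> exists y', S y' /\ y < y').
Proof.
  intros HB. destruct (classic (exists y, S y)) as [Hex|Hno].
  - destruct (completeness S) as [M [H1 H2]]; [exists B; exact HB|exact Hex|].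
    exists M. split.
    + intros y Hy HS. apply H1 in HS. lra.
    + intros y _ Hy. apply NNPP. intros Hn. assert (M <= y); [|lra].
      apply H2. intros y' Hy'. apply Rnot_lt_le. intros Hlt. apply Hn. exists y'; auto.
  - exists 0. split; [intros y _ HS; apply Hno; exists y; exact HS|intros y H1 H2; lra].
Qed.

Section Thresholds.
Variables (d1 d2 r L a1 a2 x2 : R).
Hypotheses (Hd1 : 0 < d1) (Hd2 : 0 < d2) (HL : 0 < L) (Ha1 : 0 < a1)
  (Ha2 : 0 <= a2) (Hx2 : 0 < x2) (Hx2L : x2 <= L).

Lemma wbar_eigenvalue_exists (h q m : R) (wb : R -> R) : 0 < m -> is_wbar d2 a2 h q x2 wb ->
  exists lam, wbar_eigenvalue d1 a1 r L x2 m wb lam /\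
    is_principal_eig d1 a1 (fun x => r - m * chi x2 x * wb x) 0 L lam.
Proof.
  intros Hm Hwb.
  destruct (eigenpair_exists d1 a1 r x2 L (fun x => m * wb (clamp x2 x))) as (lam & f & f1 & Hf);
    try assumption.
  { intros x. apply (continuous_mult (fun _ => m) (fun x => wb (clamp x2 x)));
      [apply continuous_const|]. apply clamp_comp_continuous; [lra|apply Hwb]. }
  { intros x _. apply Rmult_le_pos; [lra|]. left. apply Hwb, clamp_range. lra. }
  exists lam. split; [exists f, f1; exact Hf|].
  apply (eigenpair_principal d1 a1 r m x2 L lam _ wb f f1 Hd1 HL Hf).
  intros x Hx. rewrite clamp_id by lra. reflexivity.
Qed.

Lemma wbar_eigenvalue_mono (m m' lam lam' : R) (wb wb' : R -> R) :
  wbar_eigenvalue d1 a1 r L x2 m wb lam -> wbar_eigenvalue d1 a1 r L x2 m' wb' lam' ->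
  (forall x, 0 < x < x2 -> m' * wb' x < m * wb x) -> lam < lam'.
Proof.
  intros (f & f1 & Hf) (g & g1 & Hg) Hlt.
  apply (eigenvalue_strict_mono d1 a1 r x2 L Hd1 Hx2 Hx2L _ _ _ _ _ _ _ _ Hf Hg).
  intros x Hx. rewrite clamp_id by lra. apply Hlt, Hx.
Qed.

Lemma wbar_strict_mono (h q q' : R) (wb wb' : R -> R) : 0 < h -> 0 < q -> q < q' ->
  is_wbar d2 a2 h q x2 wb -> is_wbar d2 a2 h q' x2 wb' ->
  forall x, 0 <= x <= x2 -> wb' x < wb x.
Proof.
  intros Hh Hq Hqq Hwb Hwb' x Hx.
  set (k := h / q' * exp (- (a2 / d2 * x2))).
  assert (Hk : 0 < k) by (apply Rmult_lt_0_compat; [apply Rdiv_lt_0_compat; lra|apply exp_pos]).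
  assert (Hlow : forall y, 0 <= y <= x2 -> k <= wb' y).
  { intros y Hy. apply (wbar_lower d2 a2 h q' x2 wb'); try assumption; lra. }
  set (e := (q' - q) * k / h).
  assert (He : 0 < e) by (apply Rdiv_lt_0_compat; [apply Rmult_lt_0_compat|]; lra).
  assert (Hc : (1 + e) * wb' x <= wb x).
  { apply (wbar_compare d2 a2 h q x2 wb Hd2 Ha2 Hq Hx2 Hwb q' (1 + e) wb' Hwb'); [|exact Hx].
    intros y Hy. specialize (Hlow y ltac:(lra)).
    replace ((1 + e - 1) * h) with ((q' - q) * k) by (unfold e; field; lra).
    assert ((q' - q) * k <= (q' - q) * wb' y) by (apply Rmult_le_compat_l; lra).
    assert (0 < (q' - q) * wb' y) by (apply Rmult_lt_0_compat; lra).
    nra. }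
  specialize (Hlow x Hx). nra.
Qed.

Lemma mbar_exists (N h q : R) : 0 < h -> 0 < q ->
  (forall (be : R -> R) (l : R) (f f1 : R -> R),
    (forall x, 0 < x < x2 -> N <= be x) -> eigenpair d1 a1 r x2 L be l f f1 -> l < 0) ->
  exists M, forall m wb, 0 < m -> is_wbar d2 a2 h q x2 wb ->
    (m > M -> lin_stable d1 a1 r m L x2 wb) /\ (m < M -> lin_unstable d1 a1 r m L x2 wb).
Proof.
  intros Hh Hq HN.
  set (k := h / q * exp (- (a2 / d2 * x2))).
  assert (Hk : 0 < k) by (apply Rmult_lt_0_compat; [apply Rdiv_lt_0_compat; lra|apply exp_pos]).
  destruct (positive_threshold (fun m => 0 < m /\ exists wb lam, is_wbar d2 a2 h q x2 wb /\
     wbar_eigenvalue d1 a1 r L x2 m wb lam /\ 0 <= lam) (N / k)) as [M [HM1 HM2]].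
  { intros m (Hm & wb & lam & Hwb & (f & f1 & Hf) & Hlam).
    apply Rnot_lt_le. intros Hlt. apply Rlt_div_l in Hlt; [|exact Hk].
    assert (lam < 0); [|lra]. apply HN with (2 := Hf). intros x Hx.
    rewrite clamp_id by lra.
    pose proof (wbar_lower d2 a2 h q x2 wb Hd2 Ha2 Hh Hq Hx2 Hwb x ltac:(lra)) as Hw.
    fold k in Hw. nra. }
  exists M. intros m wb Hm Hwb.
  destruct (wbar_eigenvalue_exists h q m wb Hm Hwb) as (lam & Hlam & Hprin).
  split; intros Hc; exists lam; split; try exact Hprin.
  - apply Rnot_le_lt. intros Hle. apply (HM1 m); [lra|].
    split; [exact Hm|]. exists wb, lam; auto.
  - destruct (HM2 m Hm Hc) as (m' & (Hm' & wb' & lam' & Hwb' & Hlam' & Hle) & Hlt).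
    apply Rle_lt_trans with (1 := Hle).
    apply (wbar_eigenvalue_mono m' m lam' lam wb' wb Hlam' Hlam). intros x Hx.
    assert (Hw : 1 * wb x <= wb' x).
    { apply (wbar_compare d2 a2 h q x2 wb' Hd2 Ha2 Hq Hx2 Hwb' q 1 wb Hwb); [intros; lra|lra]. }
    assert (0 < wb x) by (apply Hwb; lra). nra.
Qed.

Lemma qbar_exists (lam0 h m : R) (f0 f01 : R -> R) : 0 < h -> 0 < m -> 0 < lam0 ->
  eigenpair d1 a1 r x2 L (fun _ => 0) lam0 f0 f01 ->
  exists M, forall q wb, 0 < q -> is_wbar d2 a2 h q x2 wb ->
    (q < M -> lin_stable d1 a1 r m L x2 wb) /\ (q > M -> lin_unstable d1 a1 r m L x2 wb).
Proof.
  intros Hh Hm Hl0 Hf0.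
  set (k := m * h * exp (a2 / d2 * x2)).
  assert (Hk : 0 < k) by (apply Rmult_lt_0_compat; [nra|apply exp_pos]).
  destruct (positive_threshold (fun q => 0 < q /\ exists wb lam, is_wbar d2 a2 h q x2 wb /\
     wbar_eigenvalue d1 a1 r L x2 m wb lam /\ lam <= 0) (k / (lam0 / 2))) as [M [HM1 HM2]].
  { intros q (Hq & wb & lam & Hwb & (f & f1 & Hf) & Hlam).
    apply Rnot_lt_le. intros Hlt. apply Rlt_div_l in Hlt; [|lra].
    assert (lam0 - lam0 / 2 <= lam); [|lra].
    apply (eigenvalue_perturb d1 a1 r x2 L Hd1 HL _ _ lam lam0 (lam0 / 2) _ _ _ _ ltac:(lra) Hf Hf0).
    intros x Hx. rewrite clamp_id by lra.
    pose proof (wbar_upper d2 a2 h q x2 wb Hd2 Ha2 Hh Hq Hx2 Hwb x ltac:(lra)) as Hw.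
    assert (Hmw : m * wb x <= m * (h / q * exp (a2 / d2 * x2))) by (apply Rmult_le_compat_l; lra).
    replace (m * (h / q * exp (a2 / d2 * x2))) with (k / q) in Hmw by (unfold k; field; lra).
    assert (k / q <= lam0 / 2) by (apply Rle_div_l; lra). lra. }
  exists M. intros q wb Hq Hwb.
  destruct (wbar_eigenvalue_exists h q m wb Hm Hwb) as (lam & Hlam & Hprin).
  split; intros Hc; exists lam; split; try exact Hprin.
  - destruct (HM2 q Hq Hc) as (q' & (Hq' & wb' & lam' & Hwb' & Hlam' & Hle) & Hlt).
    apply Rlt_le_trans with (2 := Hle).
    apply (wbar_eigenvalue_mono m m lam lam' wb wb' Hlam Hlam'). intros x Hx.
    apply Rmult_lt_compat_l; [exact Hm|].
    apply (wbar_strict_mono h q q' wb wb' Hh Hq Hlt Hwb Hwb'). lra.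
  - apply Rnot_le_lt. intros Hle. apply (HM1 q); [lra|].
    split; [exact Hq|]. exists wb, lam; auto.
Qed.
End Thresholds.

Theorem theorem2p5 (d1 d2 r p L a1 a2 x2 : R) :
  0 < d1 -> 0 < d2 -> 0 < r -> 0 < p -> 0 < L -> 0 < a1 -> 0 <= a2 ->
  0 < x2 -> x2 <= L ->
  (* global asymptotic stability *)
  (forall m q h, 0 < m -> 0 < q -> 0 < h ->
     (a1 >= sqrt (4 * d1 * r) \/
      (a1 < sqrt (4 * d1 * r) /\ L < L1star d1 a1 r)) ->
     forall wb, is_wbar d2 a2 h q x2 wb ->
       glob_asympt_stable d1 d2 r m p q h L a1 a2 x2 wb) /\
  (a1 < sqrt (4 * d1 * r) -> L > L1star d1 a1 r ->
     (* (i) large protection zone *)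
     (L - x2 >= Lstar d1 a1 r ->
        forall m q h, 0 < m -> 0 < q -> 0 < h ->
        forall wb, is_wbar d2 a2 h q x2 wb -> lin_unstable d1 a1 r m L x2 wb) /\
     (* (ii) small protection zone *)
     (L - x2 < Lstar d1 a1 r ->
        (* (ii.1) *)
        (forall q, 0 < q -> exists mbar : R -> R,
           forall h m, 0 < h -> 0 < m ->
           forall wb, is_wbar d2 a2 h q x2 wb ->
             (m > mbar h -> lin_stable d1 a1 r m L x2 wb) /\
             (m < mbar h -> lin_unstable d1 a1 r m L x2 wb)) /\
        (* (ii.2) *)
        (forall h, 0 < h -> exists qbar : R -> R,
           forall q m, 0 < q -> 0 < m ->
           forall wb, is_wbar d2 a2 h q x2 wb ->
             (q < qbar m -> lin_stable d1 a1 r m L x2 wb) /\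
             (q > qbar m -> lin_unstable d1 a1 r m L x2 wb)))).
Proof.
  intros Hd1 Hd2 Hr Hp HL Ha1 Ha2 Hx2 Hx2L.
  destruct (eigenpair_exists d1 a1 r x2 L (fun _ => 0)) as (lam0 & f0 & f01 & Hf0); try assumption.
  { intros; apply continuous_const. }
  { intros; lra. }
  assert (Hom : forall s y z, 0 < s ->
    (y < 2 * d1 * z / s <-> s / (2 * d1) * y < z) /\ (2 * d1 * z / s < y <-> z < s / (2 * d1) * y)
     /\ (2 * d1 * z / s <= y <-> z <= s / (2 * d1) * y)).
  { intros s y z Hs.
    assert (E1 : y = 2 * d1 / s * (s / (2 * d1) * y)) by (field; lra).
    assert (E2 : 2 * d1 * z / s = 2 * d1 / s * z) by (field; lra).
    assert (Hc : 0 < 2 * d1 / s) by (apply Rdiv_lt_0_compat; lra).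
    rewrite E2. rewrite E1 at 1 3 5.
    repeat split; intros H; first [apply Rmult_lt_reg_l with (1 := Hc); exact H
      |apply Rmult_le_reg_l with (1 := Hc); exact H
      |apply Rmult_lt_compat_l; assumption|apply Rmult_le_compat_l; lra]. }
  split.
  - intros m q h Hm Hq Hh Hcase wb Hwb u0 w0 u w Hcu Hcw Hu0 _ Hw0 _ Hsol.
    assert (Hlam : lam0 < 0).
    { destruct Hcase as [Hstrong|[Hweak Hshort]].
      - apply (eigenvalue_neg_strong_drift d1 a1 r x2 L Hd1 Ha1 HL lam0 f0 f01); [|exact Hf0].
        apply strong_drift; assumption.
      - destruct (weak_drift d1 a1 r Hd1 Hr Ha1 Hweak) as [Hs Has].
        rewrite (L1star_eq d1 a1 r _ Ha1 Hs Has eq_refl) in Hshort.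
        apply (eigenvalue_neg_short d1 a1 r x2 L Hd1 Ha1 HL _ Hs Has lam0 f0 f01); [|exact Hf0].
        apply Hom; assumption. }
    apply (solution_converges d1 d2 r m p q h L a1 a2 x2 lam0 wb f0 f01 u0 w0 u w); assumption.
  - intros Hweak Hlong.
    destruct (weak_drift d1 a1 r Hd1 Hr Ha1 Hweak) as [Hs Has].
    rewrite (L1star_eq d1 a1 r _ Ha1 Hs Has eq_refl) in Hlong.
    rewrite (Lstar_eq d1 a1 r _ Ha1 Hs eq_refl).
    set (s := sqrt (4 * d1 * r - a1 ^ 2)) in *.
    split; [|intros Hsmall; split].
    + intros Hlarge m q h Hm Hq Hh wb Hwb.
      destruct (wbar_eigenvalue_exists d1 d2 r L a1 a2 x2 Hd1 HL Ha1 Hx2 h q m wb Hm Hwb)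
        as (lam & (f & f1 & Hf) & Hprin).
      exists lam. split; [exact Hprin|].
      apply (eigenvalue_pos_protection d1 a1 r x2 L Hd1 Ha1 Hx2 s Hs Has
        (fun x => m * wb (clamp x2 x)) lam f f1); [|exact Hf].
      apply (proj2 (proj2 (Hom s (L - x2) _ Hs))), Rge_le, Hlarge.
    + intros q Hq.
      destruct (eigenvalue_neg_large_potential d1 a1 r x2 L Hd1 Ha1 Hr HL Hx2 Hx2L s Hs Has)
        as (N & HN0 & HN); [apply Hom; assumption|].
      assert (Hex : forall h, exists M, 0 < h -> forall m wb, 0 < m -> is_wbar d2 a2 h q x2 wb ->
        (m > M -> lin_stable d1 a1 r m L x2 wb) /\ (m < M -> lin_unstable d1 a1 r m L x2 wb)).
      { intros h. destruct (Rlt_dec 0 h) as [Hh|Hh]; [|exists 0; intros; contradiction].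
        destruct (mbar_exists d1 d2 r L a1 a2 x2 Hd1 Hd2 HL Ha1 Ha2 Hx2 Hx2L N h q Hh Hq HN) as [M HM].
        exists M. intros _. exact HM. }
      exists (fun h => proj1_sig (constructive_indefinite_description _ (Hex h))).
      intros h m Hh Hm wb Hwb.
      exact (proj2_sig (constructive_indefinite_description _ (Hex h)) Hh m wb Hm Hwb).
    + intros h Hh.
      assert (Hl0 : 0 < lam0).
      { apply (eigenvalue_pos_long d1 a1 r x2 L Hd1 Ha1 s Hs Has lam0 f0 f01); [|exact Hf0].
        apply Hom; assumption. }
      assert (Hex : forall m, exists M, 0 < m -> forall q wb, 0 < q -> is_wbar d2 a2 h q x2 wb ->
        (q < M -> lin_stable d1 a1 r m L x2 wb) /\ (q > M -> lin_unstable d1 a1 r m L x2 wb)).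
      { intros m. destruct (Rlt_dec 0 m) as [Hm|Hm]; [|exists 0; intros; contradiction].
        destruct (qbar_exists d1 d2 r L a1 a2 x2 Hd1 Hd2 HL Ha1 Ha2 Hx2 Hx2L lam0 h m f0 f01
          Hh Hm Hl0 Hf0) as [M HM].
        exists M. intros _. exact HM. }
      exists (fun m => proj1_sig (constructive_indefinite_description _ (Hex m))).
      intros q m Hq Hm wb Hwb.
      exact (proj2_sig (constructive_indefinite_description _ (Hex m)) Hm q wb Hq Hwb).
Qed.
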